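(* Let $L/K$ be a finite Galois extension with group $\Gamma$, let $\mathcal C$ be a split fusion category over $L$, and let $\Phi$ be a section of $p_{\mathrm{sf}}:\Pi_{\mathrm{sf}}(\mathcal C/K)\to\Gamma$. Let $X_1,\dots,X_r,Z$ be simple objects with $$n=N_{X_1,\dots,X_r}^{Z}=\dim_L\operatorname{Hom}(X_1\otimes\cdots\otimes X_r,Z)>0.$$ Then $$\operatorname{ind}\bigl((\lambda_{X_1,\dots,X_r}^{Z})_*\,\Omega_\Phi(\mathcal C)\bigr)\ \big|\ n .$$ If $\Phi$ admits a coherent structure $J$, then $$(\lambda_{X_1,\dots,X_r}^{Z})_*\,\Omega_\Phi(\mathcal C)=\beta_Z(J)-\sum_{i=1}^r\beta_{X_i}(J).$$ In particular, $n\bigl(\beta_Z(J)-\sum_{i=1}^r\beta_{X_i}(J)\bigr)=0$.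
   Context: A fusion category over a field $F$ is an $F$-linear semisimple abelian category with finite-dimensional morphism spaces, finitely many simple isomorphism classes, and a rigid monoidal structure with $\operatorname{End}(\mathbf 1)=F$; it is split if $\operatorname{End}(X)=F$ for every simple $X$. $\operatorname{Irr}(\mathcal C)$: simple isomorphism classes, with fixed representatives. For $\sigma\in\Gamma$, ${}^\sigma\mathcal C$ is $\mathcal C$ with scalars twisted by $\sigma$, and ${}^\sigma X$ is $X$ viewed there. $\Pi_{\mathrm{sf}}(\mathcal C/K)$ is the group of tensor-natural-isomorphism classes of pairs $(F,\sigma)$, $F:{}^\sigma\mathcal C\to\mathcal C$ an $L$-linear tensor equivalence with $F({}^\sigma X)\cong X$ for every simple $X$, under $(F,\sigma)(G,\tau)=(F\circ{}^\sigma G,\sigma\tau)$; $p_{\mathrm{sf}}$ sends $[(F,\sigma)]$ to $\sigma$, and a section is a group homomorphism splitting it. A frame on $(F,\sigma)$ is a family of isomorphisms $f_X:F({}^\sigma X)\to X$, $X\in\operatorname{Irr}(\mathcal C)$. Framed pairs $(F,\sigma,\mathbf f)$, $(F',\sigma,\mathbf f')$ are equivalent if there is a tensor natural isomorphism $\eta:F\Rightarrow F'$ with $f'_X\circ\eta_{{}^\sigma X}=f_X$ for all $X$; with composition $(F,\sigma,\mathbf f)(G,\tau,\mathbf g)=(F\circ{}^\sigma G,\sigma\tau,(f_X\circ F({}^\sigma g_X))_X)$ the classes form a group $\Pi_{\mathrm{fr}}(\mathcal C/K)$. $\operatorname{Aut}(\mathrm{id}_{\mathcal C})\cong(L^\times)^{\operatorname{Irr}(\mathcal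 C)}$ is the group of natural automorphisms of the identity functor, $\operatorname{Aut}_\otimes(\mathrm{id}_{\mathcal C})$ its subgroup of monoidal ones, both with $\Gamma$-action $(\sigma\cdot e)_X=\sigma(e_X)$, and $Q_\Phi$ is the quotient $\Gamma$-module. There is an exact sequence $1\to Q_\Phi\to\Pi_{\mathrm{fr}}(\mathcal C/K)\to\Pi_{\mathrm{sf}}(\mathcal C/K)\to1$ ($e\mapsto(\mathrm{id}_{\mathcal C},1,(e_X)_X)$, then forgetting frames); its pullback along $\Phi$ is an extension of $\Gamma$ by $Q_\Phi$, whose class (of the factor set $\overline b$ given by (lift of $\sigma$)(lift of $\tau$) $=\overline b_{\sigma,\tau}\cdot$(lift of $\sigma\tau$)) is $\Omega_\Phi(\mathcal C)\in H^2(\Gamma,Q_\Phi)$. When $N_{X_1,\dots,X_r}^Z>0$, the formula $\lambda_{X_1,\dots,X_r}^{Z}:Q_\Phi\to L^\times$, $[(u_T)_T]\mapsto u_Z/(u_{X_1}\cdots u_{X_r})$, is a well-defined $\Gamma$-equivariant homomorphism. $\operatorname{Br}(K)$ is the Brauer group (written additively), $\operatorname{Br}(L/K)=\ker(\operatorname{Br}(K)\to\operatorname{Br}(L))\cong H^2(\Gamma,L^\times)$, and $\operatorname{ind}(\alpha)$ is the degree of the division algebra representing $\alpha$. The identification $H^2(\Gamma,L^\times)\cong\operatorname{Br}(L/K)$ is: if $T_\sigma$ are $\sigma$-semilinear operators on a finite-dimensional $L$-space $V$ with $T_\sigma T_\tau=d(\sigma,\tau)T_{\sigma\tau}$, then $[d]$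 corresponds to the class of the fixed algebra of $A\mapsto T_\sigma AT_\sigma^{-1}$ on $\operatorname{End}_L(V)$. A coherent structure $J$ on $\Phi$ consists of representatives $\Phi_\sigma$ of $\Phi(\sigma)$ (normalized, $\Phi_1=\mathrm{id}$) and normalized tensor natural isomorphisms $J_{\sigma,\tau}:\Phi_\sigma\circ{}^\sigma\Phi_\tau\Rightarrow\Phi_{\sigma\tau}$ with $J_{\sigma\tau,\rho}\circ(J_{\sigma,\tau}*\mathrm{id})=J_{\sigma,\tau\rho}\circ(\mathrm{id}*{}^\sigma J_{\tau,\rho})$. Choosing isomorphisms $f_{\sigma,X}:\Phi_\sigma({}^\sigma X)\to X$, define $b_X(\sigma,\tau)\in L^\times$ by $f_{\sigma,X}\circ\Phi_\sigma({}^\sigma f_{\tau,X})=b_X(\sigma,\tau)f_{\sigma\tau,X}\circ(J_{\sigma,\tau})_{{}^{\sigma\tau}X}$; then $\beta_X(J)=[b_X]\in H^2(\Gamma,L^\times)\cong\operatorname{Br}(L/K)$. *)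

(* Defs.v *)
From HB Require Import structures.
From mathcomp Require Import all_boot all_order all_algebra all_fingroup all_field.
From mathcomp Require Import boolp classical_sets.

Set Implicit Arguments.
Unset Strict Implicit.
Unset Printing Implicit Defensive.

Import GRing.Theory.

Local Open Scope ring_scope.
Local Open Scope quotient_scope.

Declare Scope cat_scope.
Delimit Scope cat_scope with cat.
Local Open Scope cat_scope.

Reserved Notation "g ∘ f" (at level 40, left associativity).
Reserved Notation "X ⊗ Y" (at level 38, left associativity).
Reserved Notation "f ⊗ₘ g" (at level 38, left associativity).

Record lincat (F : fieldType) : Type := LinCat {
  obj :> Type;
  hom : obj -> obj -> vectType F;
  idm : forall X, hom X X;
  cmp : forall X Y Z, hom Y Z -> hom X Y -> hom X Z;
  cmp1m : forall X Y (f : hom X Y), cmp (idm Y) f = f;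
  cmpm1 : forall X Y (f : hom X Y), cmp f (idm X) = f;
  cmpA : forall W X Y Z (f : hom Y Z) (g : hom X Y) (h : hom W X),
    cmp f (cmp g h) = cmp (cmp f g) h;
  cmp_linl : forall X Y Z (f : hom X Y), linear (fun g : hom Y Z => cmp g f);
  cmp_linr : forall X Y Z (g : hom Y Z), linear (fun f : hom X Y => cmp g f)
}.

Arguments hom {F l} X Y.
Arguments idm {F l} X.
Arguments cmp {F l X Y Z} g f.
Notation "g ∘ f" := (cmp g f) : cat_scope.

Section LinCatTheory.
Variables (F : fieldType) (C : lincat F).
Implicit Types X Y Z W : C.

Definition is_iso X Y (f : hom X Y) : Prop :=
  exists g : hom Y X, g ∘ f = idm X /\ f ∘ g = idm Y.

Definition isomorphic X Y : Prop := exists f : hom X Y, is_iso f.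

Definition mono X Y (f : hom X Y) : Prop :=
  forall W (g h : hom W X), f ∘ g = f ∘ h -> g = h.

Definition epi X Y (f : hom X Y) : Prop :=
  forall W (g h : hom Y W), g ∘ f = h ∘ f -> g = h.

Definition is_zero X : Prop :=
  forall Y, (forall f : hom X Y, f = 0) /\ (forall f : hom Y X, f = 0).

Definition is_kernel X Y W (f : hom X Y) (k : hom W X) : Prop :=
  f ∘ k = 0 /\
  forall V (g : hom V X), f ∘ g = 0 -> exists! h : hom V W, k ∘ h = g.

Definition is_cokernel X Y W (f : hom X Y) (c : hom Y W) : Prop :=
  c ∘ f = 0 /\
  forall V (g : hom Y V), g ∘ f = 0 -> exists! h : hom W V, h ∘ c = g.

Definition is_direct_sum (I : finType) (S : I -> C) X
    (inc : forall i, hom (S i) X) (prj : forall i, hom X (S i)) : Prop :=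
  [/\ forall i, prj i ∘ inc i = idm (S i),
      forall i j, i != j -> prj i ∘ inc j = 0
    & \sum_i (inc i ∘ prj i) = idm X].

Definition abelian_cat : Prop :=
  [/\ exists X, is_zero X,
      forall S : bool -> C, exists X inc prj, @is_direct_sum bool S X inc prj,
      forall X Y (f : hom X Y),
        (exists W (k : hom W X), is_kernel f k) /\
        (exists W (c : hom Y W), is_cokernel f c)
    & forall X Y (f : hom X Y),
        (mono f -> exists Z (g : hom Y Z), is_kernel g f) /\
        (epi f -> exists Z (g : hom Z X), is_cokernel g f)].

Definition simple X : Prop :=
  ~ is_zero X /\
  forall Y (f : hom Y X), mono f -> is_zero Y \/ is_iso f.

Definition semisimple_cat : Prop :=
  forall X, exists (n : nat) (S : 'I_n -> C) inc prj,
    (forall i, simple (S i)) /\ @is_direct_sum 'I_n S X inc prj.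

Record simple_obj := SimpleObj { so_obj :> C; so_simple : simple so_obj }.

End LinCatTheory.

Record tenscat (F : fieldType) : Type := TensCat {
  tc_cat :> lincat F;
  tens : tc_cat -> tc_cat -> tc_cat;
  tensm : forall X X' Y Y' : tc_cat,
    hom X X' -> hom Y Y' -> hom (tens X Y) (tens X' Y');
  tensm1 : forall X Y : tc_cat, tensm (idm X) (idm Y) = idm (tens X Y);
  tensm_cmp : forall (X X' X'' Y Y' Y'' : tc_cat)
    (f' : hom X' X'') (f : hom X X') (g' : hom Y' Y'') (g : hom Y Y'),
    tensm (f' ∘ f) (g' ∘ g) = tensm f' g' ∘ tensm f g;
  tensm_linl : forall (X X' Y Y' : tc_cat) (g : hom Y Y'),
    linear (fun f : hom X X' => tensm f g);
  tensm_linr : forall (X X' Y Y' : tc_cat) (f : hom X X'),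
    linear (fun g : hom Y Y' => tensm f g);
  tunit : tc_cat;
  asc : forall X Y Z : tc_cat, hom (tens (tens X Y) Z) (tens X (tens Y Z));
  ascV : forall X Y Z : tc_cat, hom (tens X (tens Y Z)) (tens (tens X Y) Z);
  lun : forall X : tc_cat, hom (tens tunit X) X;
  run : forall X : tc_cat, hom (tens X tunit) X;
  ascVK : forall X Y Z : tc_cat, ascV X Y Z ∘ asc X Y Z = idm _;
  ascKV : forall X Y Z : tc_cat, asc X Y Z ∘ ascV X Y Z = idm _;
  lun_iso : forall X : tc_cat, is_iso (lun X);
  run_iso : forall X : tc_cat, is_iso (run X);
  asc_nat : forall (X X' Y Y' Z Z' : tc_cat)
    (f : hom X X') (g : hom Y Y') (h : hom Z Z'),
    asc X' Y' Z' ∘ tensm (tensm f g) h = tensm f (tensm g h) ∘ asc X Y Z;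
  lun_nat : forall (X X' : tc_cat) (f : hom X X'),
    lun X' ∘ tensm (idm tunit) f = f ∘ lun X;
  run_nat : forall (X X' : tc_cat) (f : hom X X'),
    run X' ∘ tensm f (idm tunit) = f ∘ run X;
  pentagon : forall W X Y Z : tc_cat,
    asc W X (tens Y Z) ∘ asc (tens W X) Y Z
    = tensm (idm W) (asc X Y Z) ∘ asc W (tens X Y) Z
      ∘ tensm (asc W X Y) (idm Z);
  triangle : forall X Y : tc_cat,
    tensm (idm X) (lun Y) ∘ asc X tunit Y = tensm (run X) (idm Y)
}.

Arguments tens {F t} X Y.
Arguments tensm {F t X X' Y Y'} f g.
Arguments tunit {F t}.
Arguments asc {F t} X Y Z.
Arguments ascV {F t} X Y Z.
Arguments lun {F t} X.
Arguments run {F t} X.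
Notation "X ⊗ Y" := (tens X Y) : cat_scope.
Notation "f ⊗ₘ g" := (tensm f g) : cat_scope.

Section TensCatTheory.
Variables (F : fieldType) (C : tenscat F).

(* Y is a left dual of X. *)
Definition is_left_dual (X Y : C) : Prop :=
  exists (ev : hom (Y ⊗ X) tunit) (coev : hom tunit (X ⊗ Y)),
    run X ∘ (idm X ⊗ₘ ev) ∘ asc X Y X ∘ (coev ⊗ₘ idm X) = lun X /\
    lun Y ∘ (ev ⊗ₘ idm Y) ∘ ascV Y X Y ∘ (idm Y ⊗ₘ coev) = run Y.

Definition rigid : Prop :=
  forall X : C, (exists Y, is_left_dual X Y) /\ (exists Y, is_left_dual Y X).

Fixpoint tens_from (X : C) (s : seq C) : C :=
  if s is Y :: s' then tens_from (X ⊗ Y) s' else X.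

(* X_1 ⊗ ... ⊗ X_r, bracketed to the left (and the unit for r = 0). *)
Definition tens_seq (s : seq C) : C :=
  if s is X :: s' then tens_from X s' else tunit.

End TensCatTheory.

(* Irr(C) is part of the data, with its representatives irr_obj. *)
Record fusion (F : fieldType) : Type := Fusion {
  fus_tens :> tenscat F;
  fus_abelian : abelian_cat fus_tens;
  fus_semisimple : semisimple_cat fus_tens;
  irr : finType;
  irr_obj : irr -> fus_tens;
  irr_simple : forall i, simple (irr_obj i);
  irr_cover : forall X : fus_tens, simple X ->
    exists i, isomorphic X (irr_obj i);
  irr_inj : forall i j, isomorphic (irr_obj i) (irr_obj j) -> i = j;
  fus_rigid : rigid fus_tens;
  fus_unit : forall f : hom (@tunit F fus_tens) tunit,
    exists! a : F, f = a *: idm tunit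
}.

Arguments irr_obj {F _} i.

Definition split_fusion (F : fieldType) (C : fusion F) : Prop :=
  forall X : C, simple X ->
    forall f : hom X X, exists! a : F, f = a *: idm X.

Section FusionTheory.
Variables (F : fieldType) (C : fusion F).

Definition irr_class (X : simple_obj C) : irr C :=
  sval (cid (irr_cover (so_simple X))).

Definition fusion_mult (Xs : seq (simple_obj C)) (Z : simple_obj C) : nat :=
  \dim {:hom (tens_seq [seq so_obj X | X <- Xs]) Z}.

End FusionTheory.

Record tfunctor (F : fieldType) (C : tenscat F) : Type := TFunctor {
  fob :> C -> C;
  fmap : forall X Y : C, hom X Y -> hom (fob X) (fob Y);
  fmap1 : forall X, fmap (idm X) = idm (fob X);
  fmap_cmp : forall (X Y Z : C) (g : hom Y Z) (f : hom X Y),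
    fmap (g ∘ f) = fmap g ∘ fmap f;
  fmu : forall X Y : C, hom (fob X ⊗ fob Y) (fob (X ⊗ Y));
  feps : hom tunit (fob tunit);
  fmu_iso : forall X Y, is_iso (fmu X Y);
  feps_iso : is_iso feps;
  fmu_nat : forall (X X' Y Y' : C) (f : hom X X') (g : hom Y Y'),
    fmu X' Y' ∘ (fmap f ⊗ₘ fmap g) = fmap (f ⊗ₘ g) ∘ fmu X Y;
  fmu_asc : forall X Y Z : C,
    fmap (asc X Y Z) ∘ fmu (X ⊗ Y) Z ∘ (fmu X Y ⊗ₘ idm (fob Z))
    = fmu X (Y ⊗ Z) ∘ (idm (fob X) ⊗ₘ fmu Y Z)
      ∘ asc (fob X) (fob Y) (fob Z);
  fmu_lun : forall X : C,
    fmap (lun X) ∘ fmu tunit X ∘ (feps ⊗ₘ idm (fob X)) = lun (fob X);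
  fmu_run : forall X : C,
    fmap (run X) ∘ fmu X tunit ∘ (idm (fob X) ⊗ₘ feps) = run (fob X)
}.

Arguments fmap {F C} t {X Y} f.
Arguments fmu {F C} t X Y.
Arguments feps {F C} t.

Record tnatiso (F : fieldType) (C : tenscat F) (G H : tfunctor C) : Type :=
  TNatIso {
  tn :> forall X : C, hom (G X) (H X);
  tn_iso : forall X, is_iso (tn X);
  tn_nat : forall (X Y : C) (f : hom X Y), tn Y ∘ fmap G f = fmap H f ∘ tn X;
  tn_mu : forall X Y : C,
    tn (X ⊗ Y) ∘ fmu G X Y = fmu H X Y ∘ (tn X ⊗ₘ tn Y);
  tn_eps : tn tunit ∘ feps G = feps H
}.

Definition is_equivalence (F : fieldType) (C : tenscat F) (G : tfunctor C) :=
  (forall X Y : C, bijective (@fmap F C G X Y)) /\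
  (forall Y : C, exists X : C, isomorphic (G X) Y).

Section IsoTheory.
Variables (F : fieldType) (C : lincat F).

Lemma iso_idm (X : C) : is_iso (idm X).
Proof. by exists (idm X); rewrite cmp1m. Qed.

Lemma iso_cmp (X Y Z : C) (g : hom Y Z) (f : hom X Y) :
  is_iso g -> is_iso f -> is_iso (g ∘ f).
Proof.
case=> g' [g'g gg'] [f' [f'f ff']]; exists (f' ∘ g'); split.
  by rewrite cmpA -(cmpA f') g'g cmpm1.
by rewrite cmpA -(cmpA g) ff' cmpm1.
Qed.

Definition invm (X Y : C) (f : hom X Y) (h : is_iso f) : hom Y X := sval (cid h).

Lemma invmK (X Y : C) (f : hom X Y) (h : is_iso f) : invm h ∘ f = idm X.
Proof. by rewrite /invm; case: (cid h) => g []. Qed.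

Lemma invmVK (X Y : C) (f : hom X Y) (h : is_iso f) : f ∘ invm h = idm Y.
Proof. by rewrite /invm; case: (cid h) => g []. Qed.

Lemma iso_invm (X Y : C) (f : hom X Y) (h : is_iso f) : is_iso (invm h).
Proof. by exists f; rewrite invmK invmVK. Qed.

Lemma iso_monic (X Y : C) (f : hom X Y) : is_iso f -> mono f.
Proof.
by case=> g [gf _] W h k /(congr1 (cmp g)); rewrite !cmpA gf !cmp1m.
Qed.

Lemma iso_epic (X Y : C) (f : hom X Y) : is_iso f -> epi f.
Proof.
case=> g [_ fg] W h k /(congr1 (fun m => m ∘ g)).
by rewrite -!cmpA fg !cmpm1.
Qed.

Lemma cmpZl (X Y Z : C) (a : F) (g : hom Y Z) (f : hom X Y) :
  (a *: g) ∘ f = a *: (g ∘ f).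
Proof.
exact: (scalable_linear (@cmp_linl F C X Y Z f)).
Qed.

Lemma cmpZr (X Y Z : C) (a : F) (g : hom Y Z) (f : hom X Y) :
  g ∘ (a *: f) = a *: (g ∘ f).
Proof.
exact: (scalable_linear (@cmp_linr F C X Y Z g)).
Qed.

End IsoTheory.

Section TFunctorTheory.
Variables (F : fieldType) (C : tenscat F).
Implicit Types G H : tfunctor C.

Lemma fmap_iso G (X Y : C) (f : hom X Y) : is_iso f -> is_iso (fmap G f).
Proof.
by case=> g [gf fg]; exists (fmap G g); rewrite -!fmap_cmp gf fg !fmap1.
Qed.

Lemma tensm_iso (X X' Y Y' : C) (f : hom X X') (g : hom Y Y') :
  is_iso f -> is_iso g -> is_iso (f ⊗ₘ g).
Proof.
case=> f' [f'f ff'] [g' [g'g gg']]; exists (f' ⊗ₘ g').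
by rewrite -!tensm_cmp f'f g'g ff' gg' !tensm1.
Qed.

Lemma tensm_cmp1 (X X' X'' Y : C) (f' : hom X' X'') (f : hom X X') :
  (f' ∘ f) ⊗ₘ idm Y = (f' ⊗ₘ idm Y) ∘ (f ⊗ₘ idm Y).
Proof. by rewrite -tensm_cmp cmp1m. Qed.

Lemma tens1m_cmp (X X' X'' Y : C) (f' : hom X' X'') (f : hom X X') :
  idm Y ⊗ₘ (f' ∘ f) = (idm Y ⊗ₘ f') ∘ (idm Y ⊗ₘ f).
Proof. by rewrite -tensm_cmp cmp1m. Qed.

Lemma tensmZl (X X' Y Y' : C) a (f : hom X X') (g : hom Y Y') :
  (a *: f) ⊗ₘ g = a *: (f ⊗ₘ g).
Proof. exact: (scalable_linear (@tensm_linl F C X X' Y Y' g)). Qed.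

Lemma tensmZr (X X' Y Y' : C) a (f : hom X X') (g : hom Y Y') :
  f ⊗ₘ (a *: g) = a *: (f ⊗ₘ g).
Proof. exact: (scalable_linear (@tensm_linr F C X X' Y Y' f)). Qed.

Program Definition tf_id : tfunctor C := @TFunctor F C id (fun _ _ f => f)
  _ _ (fun X Y => idm (X ⊗ Y)) (idm tunit) _ _ _ _ _ _.
Next Obligation. exact: iso_idm. Qed.
Next Obligation. exact: iso_idm. Qed.
Next Obligation. by rewrite cmp1m cmpm1. Qed.
Next Obligation. by rewrite !tensm1 !cmpm1 cmp1m. Qed.
Next Obligation. by rewrite tensm1 !cmpm1. Qed.
Next Obligation. by rewrite tensm1 !cmpm1. Qed.

Program Definition tf_comp G H : tfunctor C := @TFunctor F C
  (fun X => G (H X)) (fun _ _ f => fmap G (fmap H f)) _ _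
  (fun X Y => fmap G (fmu H X Y) ∘ fmu G (H X) (H Y))
  (fmap G (feps H) ∘ feps G) _ _ _ _ _ _.
Next Obligation. by rewrite !fmap1. Qed.
Next Obligation. by rewrite !fmap_cmp. Qed.
Next Obligation. by apply: iso_cmp (fmap_iso _ _) _; apply: fmu_iso. Qed.
Next Obligation. by apply: iso_cmp (fmap_iso _ _) _; apply: feps_iso. Qed.
Next Obligation.
by rewrite -cmpA fmu_nat cmpA -fmap_cmp fmu_nat fmap_cmp -cmpA.
Qed.
Next Obligation.
rewrite tensm_cmp1 tens1m_cmp -!cmpA.
rewrite (cmpA _ (fmap G (fmu H X Y) ⊗ₘ _)) -{1}(fmap1 G) fmu_nat.
rewrite -(cmpA (fmap G _)) !cmpA -!fmap_cmp fmu_asc -!cmpA.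
rewrite (cmpA (fmu G (H X) _)) -{1}(fmap1 G (H X)) fmu_nat -!cmpA.
by rewrite (cmpA (fmu G (H X) (H Y ⊗ H Z))) -fmu_asc !fmap_cmp -!cmpA.
Qed.
Next Obligation.
rewrite tensm_cmp1 -!cmpA (cmpA _ (fmap G (feps H) ⊗ₘ _)).
rewrite -{1}(fmap1 G) fmu_nat -(cmpA (fmap G _)) !cmpA -!fmap_cmp.
by rewrite fmu_lun fmu_lun.
Qed.
Next Obligation.
rewrite tens1m_cmp -!cmpA (cmpA _ (_ ⊗ₘ fmap G (feps H))).
rewrite -{1}(fmap1 G) fmu_nat -(cmpA (fmap G _)) !cmpA -!fmap_cmp.
by rewrite fmu_run fmu_run.
Qed.

Program Definition tn_id G : tnatiso G G :=
  @TNatIso F C G G (fun X => idm (G X)) _ _ _ _.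
Next Obligation. exact: iso_idm. Qed.
Next Obligation. by rewrite cmp1m cmpm1. Qed.
Next Obligation. by rewrite tensm1 cmp1m cmpm1. Qed.
Next Obligation. by rewrite cmp1m. Qed.

Program Definition tn_inv G H (e : tnatiso G H) : tnatiso H G :=
  @TNatIso F C H G (fun X => invm (tn_iso e X)) _ _ _ _.
Next Obligation. exact: iso_invm. Qed.
Next Obligation.
apply: (iso_epic (tn_iso e X)); rewrite -!cmpA invmK cmpm1 -tn_nat.
by rewrite cmpA invmK cmp1m.
Qed.
Next Obligation.
apply: (iso_epic (tensm_iso (tn_iso e X) (tn_iso e Y))).
by rewrite -!cmpA -tn_mu -tensm_cmp !invmK tensm1 cmpm1 cmpA invmK cmp1m.
Qed.
Next Obligation. by rewrite -(tn_eps e) cmpA invmK cmp1m. Qed.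

Program Definition tn_comp G H I (e : tnatiso H I) (d : tnatiso G H) :
    tnatiso G I := @TNatIso F C G I (fun X => e X ∘ d X) _ _ _ _.
Next Obligation. by apply: iso_cmp; apply: tn_iso. Qed.
Next Obligation. by rewrite -cmpA tn_nat cmpA tn_nat cmpA. Qed.
Next Obligation. by rewrite tensm_cmp -cmpA tn_mu cmpA tn_mu cmpA. Qed.
Next Obligation. by rewrite -cmpA !tn_eps. Qed.

Program Definition tn_hcomp G G' H H' (e : tnatiso G G') (d : tnatiso H H') :
    tnatiso (tf_comp G H) (tf_comp G' H') :=
  @TNatIso F C (tf_comp G H) (tf_comp G' H')
    (fun X => e (H' X) ∘ fmap G (d X)) _ _ _ _.
Next Obligation. by apply: iso_cmp (fmap_iso _ _); apply: tn_iso. Qed.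
Next Obligation.
by rewrite /= -cmpA -fmap_cmp (tn_nat d) fmap_cmp !cmpA tn_nat.
Qed.
Next Obligation.
rewrite tensm_cmp -!cmpA (cmpA (fmap G (d (X ⊗ Y)))) -fmap_cmp tn_mu.
rewrite !fmap_cmp -(cmpA (fmap G (fmu H' X Y))) -fmu_nat !cmpA tn_nat.
by rewrite -(cmpA (fmap G' _)) tn_mu cmpA.
Qed.
Next Obligation.
by rewrite -!cmpA (cmpA (fmap G _)) -fmap_cmp tn_eps cmpA tn_nat -cmpA tn_eps.
Qed.

Lemma equivalence_id : is_equivalence tf_id.
Proof.
split=> [X Y|Y]; first by exists id.
by exists Y, (idm Y); apply: iso_idm.
Qed.

Lemma equivalence_comp G H :
  is_equivalence G -> is_equivalence H -> is_equivalence (tf_comp G H).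
Proof.
move=> [ffG esG] [ffH esH]; split=> [X Y|Y].
  exact: bij_comp (ffG _ _) (ffH X Y).
have [Z [f fi]] := esG Y; have [X [g gi]] := esH Z.
by exists X, (f ∘ fmap G g); exact: iso_cmp fi (fmap_iso G gi).
Qed.

End TFunctorTheory.

(* The multiplicative group of F, as a zmodType: written additively. *)
Record munit (F : fieldType) := MUnit { uval : F; uval_neq0 : uval != 0 }.

HB.instance Definition _ (F : fieldType) := [isSub for @uval F].
HB.instance Definition _ (F : fieldType) := [Choice of munit F by <:].

Section MUnitZmod.
Variable F : fieldType.
Implicit Types u v : munit F.

Definition munit_one : munit F := MUnit (oner_neq0 F).
Definition munit_mul u v : munit F :=
  MUnit (mulf_neq0 (uval_neq0 u) (uval_neq0 v)).
Definition munit_inv u : munit F := MUnit (invr_neq0 (uval_neq0 u)).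

Fact munit_mulA : associative munit_mul.
Proof. by move=> u v w; apply/val_inj/mulrA. Qed.
Fact munit_mulC : commutative munit_mul.
Proof. by move=> u v; apply/val_inj/mulrC. Qed.
Fact munit_mul1 : left_id munit_one munit_mul.
Proof. by move=> u; apply/val_inj/mul1r. Qed.
Fact munit_mulV : left_inverse munit_one munit_inv munit_mul.
Proof. by move=> u; apply/val_inj/mulVf/uval_neq0. Qed.

HB.instance Definition _ := GRing.isZmodule.Build (munit F)
  munit_mulA munit_mulC munit_mul1 munit_mulV.

Lemma uval0 : uval (0 : munit F) = 1. Proof. by []. Qed.
Lemma uvalD u v : uval (u + v) = uval u * uval v. Proof. by []. Qed.
Lemma uvalN u : uval (- u) = (uval u)^-1. Proof. by []. Qed.

End MUnitZmod.

Section Cohomology.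
Variables (K : fieldType) (L : splittingFieldType K).

(* gal_of {:L} is the full group of K-automorphisms of L. The product of
   MathComp is (s * t)%g a = t (s a), whence the exchange here. *)
Definition gmul (s t : gal_of {:L}) : gal_of {:L} := (t * s)%g.

Lemma gmulE s t a : gmul s t a = s (t a).
Proof. by rewrite /gmul galM ?memvf. Qed.

Lemma gmulA : associative gmul.
Proof. by move=> s t r; rewrite /gmul mulgA. Qed.

Record galmod := GalMod {
  gm_car :> zmodType;
  gm_act : gal_of {:L} -> gm_car -> gm_car;
  gm_actB : forall s x y, gm_act s (x - y) = gm_act s x - gm_act s y;
  gm_act1 : forall x, gm_act 1%g x = x;
  gm_actM : forall s t x, gm_act (gmul s t) x = gm_act s (gm_act t x)
}.

Lemma gm_act0 (M : galmod) s : gm_act s (0 : M) = 0.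
Proof. by have := gm_actB s (0 : M) 0; rewrite !subrr. Qed.

Lemma gm_actN (M : galmod) s (x : M) : gm_act s (- x) = - gm_act s x.
Proof. by rewrite -sub0r gm_actB gm_act0 sub0r. Qed.

Lemma gm_actD (M : galmod) s (x y : M) :
  gm_act s (x + y) = gm_act s x + gm_act s y.
Proof. by rewrite -[y in LHS]opprK gm_actB gm_actN opprK. Qed.

Section H2.
Variable M : galmod.

Notation cochain2 := {ffun gal_of {:L} * gal_of {:L} -> M}.

Definition cocycle2 (c : cochain2) : bool := `[<forall s t r,
  gm_act s (c (t, r)) + c (s, gmul t r) = c (s, t) + c (gmul s t, r)>].

Definition coboundary2 (h : {ffun gal_of {:L} -> M}) : cochain2 :=
  [ffun st => gm_act st.1 (h st.2) - h (gmul st.1 st.2) + h st.1].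

Fact cocycle2_closed : zmod_closed cocycle2.
Proof.
split=> [|b c /asboolP Zb /asboolP Zc]; apply/asboolP => s t r.
  by rewrite !ffunE gm_act0.
by rewrite !ffunE gm_actB addrACA -opprD Zb Zc opprD addrACA.
Qed.
HB.instance Definition _ := GRing.isZmodClosed.Build _ cocycle2 cocycle2_closed.

Record Z2 := Cocycle2 { cocycle_val :> cochain2; cocycle_valP : cocycle2 cocycle_val }.
HB.instance Definition _ := [isSub for cocycle_val].
HB.instance Definition _ := [Choice of Z2 by <:].
HB.instance Definition _ := [SubChoice_isSubZmodule of Z2 by <:].

Definition is_coboundary2 (c : Z2) : bool :=
  `[<exists h, val c = coboundary2 h>].

Fact is_coboundary2_closed : zmod_closed is_coboundary2.
Proof.
split=> [|b c /asboolP[g Bg] /asboolP[h Bh]]; apply/asboolP.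
  exists 0; apply/ffunP=> st; rewrite raddf0 !ffunE gm_act0.
  by rewrite subrr addr0.
exists (g - h); apply/ffunP=> st; rewrite raddfB /= Bg Bh !ffunE gm_actB.
by rewrite !opprD addrACA; congr (_ + _); rewrite addrACA.
Qed.
HB.instance Definition _ :=
  GRing.isZmodClosed.Build _ is_coboundary2 is_coboundary2_closed.

Definition B2 : zmodClosed Z2 := GRing.ZmodClosed.clone _ is_coboundary2 _.

Definition H2 : zmodType := Quotient.quot B2.

Definition H2_class (c : Z2) : H2 := \pi_(Quotient.quot B2) c.
Definition H2_repr (x : H2) : Z2 := generic_quotient.repr (x : Quotient.quot B2).

Lemma H2_reprK x : H2_class (H2_repr x) = x.
Proof. exact: reprK. Qed.

Lemma H2_classB c d : H2_class (c - d) = H2_class c - H2_class d.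
Proof. exact: (raddfB \pi_(Quotient.quot B2)). Qed.

Lemma H2_classP c d : reflect (H2_class c = H2_class d) (is_coboundary2 (c - d)).
Proof.
by apply: (iffP idP) => [|/eqP]; [move=> h; apply/eqP|];
   rewrite -Quotient.idealrBE.
Qed.

End H2.

Record galmod_hom (M N : galmod) := GalModHom {
  gmh :> M -> N;
  gmhB : forall x y, gmh (x - y) = gmh x - gmh y;
  gmh_act : forall s x, gmh (gm_act s x) = gm_act s (gmh x)
}.

Section H2Map.
Variables (M N : galmod) (f : galmod_hom M N).

Lemma gmh0 : f 0 = 0.
Proof. by have := gmhB f 0 0; rewrite !subrr. Qed.

Lemma gmhD x y : f (x + y) = f x + f y.
Proof.
have fN z : f (- z) = - f z by rewrite -sub0r gmhB gmh0 sub0r.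
by rewrite -[y in LHS]opprK gmhB fN opprK.
Qed.

Fact Z2_map_subproof (c : Z2 M) : cocycle2 [ffun st => f (c st)].
Proof.
have /asboolP Zc := cocycle_valP c; apply/asboolP => s t r.
by rewrite !ffunE -gmh_act -!gmhD Zc.
Qed.
Definition Z2_map (c : Z2 M) : Z2 N := Cocycle2 (Z2_map_subproof c).

Definition H2_map (x : H2 M) : H2 N := H2_class (Z2_map (H2_repr x)).

Lemma H2_map_class c : H2_map (H2_class c) = H2_class (Z2_map c).
Proof.
have /H2_classP/asboolP[h eh] := H2_reprK (H2_class c); apply/H2_classP.
apply/asboolP; exists [ffun s => f (h s)]; apply/ffunP => st.
move/ffunP/(_ st): eh; rewrite !raddfB /= !ffunE => /(congr1 f).
by rewrite gmhB gmhD gmhB gmh_act.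
Qed.

End H2Map.

Definition munit_act (s : gal_of {:L}) (u : munit L) : munit L :=
  MUnit (etrans (congr1 negb (fmorph_eq0 s (uval u))) (uval_neq0 u)).

Program Definition munit_mod : galmod :=
  @GalMod (munit L) munit_act _ _ _.
Next Obligation. by apply: val_inj; rewrite /= rmorphM fmorphV. Qed.
Next Obligation. by apply: val_inj; rewrite /= gal_id. Qed.
Next Obligation. by apply: val_inj; rewrite /= gmulE. Qed.

Definition central_division (D : falgType K) : Prop :=
  (forall x : D, x != 0 -> x \is a GRing.unit) /\
  (forall x : D, (forall y : D, x * y = y * x) -> exists a : K, x = a%:A).

(* phi identifies the matrix algebra M_{k+1}(D) with the K-algebra of the
   A in End_L(V) such that T_s A T_s^-1 = A for all s. *)
Definition fixed_algebra_iso (V : vectType L) (T : gal_of {:L} -> V -> V)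
    (D : falgType K) (k : nat) (phi : 'M[D]_k.+1 -> 'End(V)) : Prop :=
  [/\ [/\ forall A B, phi (A + B) = phi A + phi B,
          phi 1 = \1%VF,
          forall A B, phi (A * B) = (phi A \o phi B)%VF
        & forall (a : K) A, phi (map_mx (fun x => a *: x) A) = a%:A *: phi A],
      injective phi
    & forall A : 'End(V),
        (forall s v, T s (A v) = A (T s v)) <-> exists B, phi B = A].

(* D is Brauer equivalent to the fixed algebra of the semilinear operators T,
   whose cocycle is in the class c. *)
Definition represents (D : falgType K) (c : H2 munit_mod) : Prop :=
  exists (V : vectType L) (T : gal_of {:L} -> V -> V) (d : Z2 munit_mod),
    [/\ forall s a v w, T s (a *: v + w) = s a *: T s v + T s w,
        forall s, bijective (T s),
        forall s t v, T s (T t v) = uval (d (s, t)) *: T (gmul s t) v,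
        H2_class d = c
      & exists k phi, @fixed_algebra_iso V T D k phi].

Definition is_ind (c : H2 munit_mod) (m : nat) : Prop :=
  exists D : falgType K,
    [/\ central_division D, represents D c & \dim {:D} = (m ^ 2)%N].

(* If L/K is Galois, is_ind c holds of exactly one m; 0 is a junk value. *)
Definition ind (c : H2 munit_mod) : nat := xget 0%N (is_ind c).

End Cohomology.

Section Pi.
Variables (K : fieldType) (L : splittingFieldType K) (C : fusion L).

(* The twist of C by s has the objects, the morphisms and the tensor structure
   of C, with a in L acting on the morphisms by twist_scale s a. So a functor
   from the twist of C to C is a functor from C to C, and linearity is the only
   condition on it in which s plays a role. *)
Definition twist_scale (s : gal_of {:L}) (X Y : C) a (f : hom X Y) : hom X Y :=
  (s^-1)%g a *: f.

Definition twist_linear (s : gal_of {:L}) (G : tfunctor C) : Prop :=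
  forall (X Y : C) a (f g : hom X Y),
    fmap G (twist_scale s a f + g) = a *: fmap G f + fmap G g.

Lemma twist_linearP s G :
  twist_linear s G <->
  forall (X Y : C) a (f g : hom X Y),
    fmap G (a *: f + g) = s a *: fmap G f + fmap G g.
Proof.
split=> hG X Y a f g; rewrite /twist_scale; last first.
  by rewrite hG -gmulE /gmul mulVg gal_id.
by have := hG X Y (s a) f g; rewrite /twist_scale -gmulE /gmul mulgV gal_id.
Qed.

Record sfpair := SfPair {
  sf_fun :> tfunctor C;
  sf_gal : gal_of {:L};
  sf_lin : twist_linear sf_gal sf_fun;
  sf_equiv : is_equivalence sf_fun;
  sf_fix : forall X : C, simple X -> isomorphic (sf_fun X) X
}.

Program Definition sf_id : sfpair := @SfPair (tf_id C) 1%g _ _ _.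
Next Obligation. by apply/twist_linearP => X Y a f g; rewrite gal_id. Qed.
Next Obligation. exact: equivalence_id. Qed.
Next Obligation. by exists (idm X); apply: iso_idm. Qed.

Program Definition sf_comp (p q : sfpair) : sfpair :=
  @SfPair (tf_comp p q) (gmul (sf_gal p) (sf_gal q)) _ _ _.
Next Obligation.
apply/twist_linearP => X Y a f g.
by rewrite /= ((twist_linearP _ _).1 (sf_lin q)) ((twist_linearP _ _).1 (sf_lin p)) gmulE.
Qed.
Next Obligation. by apply: equivalence_comp; apply: sf_equiv. Qed.
Next Obligation.
have [f fi] := sf_fix q H; have [g gi] := sf_fix p H.
by exists (g ∘ fmap p f); exact: iso_cmp gi (fmap_iso p fi).
Qed.

Definition sf_eqv (p q : sfpair) : bool :=
  `[<sf_gal p = sf_gal q /\ inhabited (tnatiso p q)>].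

Fact sf_eqv_refl : reflexive sf_eqv.
Proof. by move=> p; apply/asboolP; split=> //; split; apply: tn_id. Qed.

Fact sf_eqv_sym : symmetric sf_eqv.
Proof.
suff sym p q : sf_eqv p q -> sf_eqv q p by move=> p q; apply/idP/idP; apply: sym.
move=> /asboolP[eqpq [e]]; apply/asboolP; split; first exact: esym.
by split; apply: tn_inv.
Qed.

Fact sf_eqv_trans : transitive sf_eqv.
Proof.
move=> q p r /asboolP[pq [e]] /asboolP[qr [d]]; apply/asboolP; split.
  exact: etrans pq qr.
by split; apply: tn_comp d e.
Qed.

HB.instance Definition _ := gen_eqMixin sfpair.
HB.instance Definition _ := gen_choiceMixin sfpair.
Canonical sf_equiv_rel := EquivRel sf_eqv sf_eqv_refl sf_eqv_sym sf_eqv_trans.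

Definition Pi_sf := {eq_quot sf_equiv_rel}.

Definition sf_class (p : sfpair) : Pi_sf := \pi_Pi_sf p.
Definition sf_repr (x : Pi_sf) : sfpair := generic_quotient.repr x.

Lemma sf_reprK x : sf_class (sf_repr x) = x.
Proof. exact: reprK. Qed.

Lemma sf_classP p q :
  sf_class p = sf_class q <-> sf_gal p = sf_gal q /\ inhabited (tnatiso p q).
Proof.
by rewrite /sf_class; split=> [/eqmodP/asboolP // | h]; apply/eqmodP/asboolP.
Qed.

Definition Pi_sf_mul (x y : Pi_sf) : Pi_sf :=
  sf_class (sf_comp (sf_repr x) (sf_repr y)).

Lemma Pi_sf_mul_class p q :
  Pi_sf_mul (sf_class p) (sf_class q) = sf_class (sf_comp p q).
Proof.
have [ep [dp]] := (sf_classP _ _).1 (sf_reprK (sf_class p)).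
have [eq [dq]] := (sf_classP _ _).1 (sf_reprK (sf_class q)).
by apply/sf_classP; rewrite /= ep eq; split=> //; split; apply: tn_hcomp.
Qed.

Definition p_sf (x : Pi_sf) : gal_of {:L} := sf_gal (sf_repr x).

Lemma p_sf_class p : p_sf (sf_class p) = sf_gal p.
Proof. by have [] := (sf_classP _ _).1 (sf_reprK (sf_class p)). Qed.

Record sf_section := SfSection {
  sec :> gal_of {:L} -> Pi_sf;
  secM : forall s t, sec (gmul s t) = Pi_sf_mul (sec s) (sec t);
  secK : forall s, p_sf (sec s) = s
}.

Record frpair := FrPair {
  fr_sf :> sfpair;
  fr_frame : forall i : irr C, hom (fr_sf (irr_obj i)) (irr_obj i);
  fr_iso : forall i, is_iso (fr_frame i)
}.

Program Definition fr_comp (p q : frpair) : frpair :=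
  @FrPair (sf_comp p q) (fun i => fr_frame p i ∘ fmap p (fr_frame q i)) _.
Next Obligation.
by apply: iso_cmp (fr_iso p i) (fmap_iso p _); apply: fr_iso.
Qed.

Definition fr_eqv (p q : frpair) : bool :=
  `[<sf_gal p = sf_gal q /\
     exists e : tnatiso p q,
       forall i, fr_frame q i ∘ e (irr_obj i) = fr_frame p i>].

Fact fr_eqv_refl : reflexive fr_eqv.
Proof.
move=> p; apply/asboolP; split=> //; exists (tn_id p) => i /=.
by rewrite cmpm1.
Qed.

Fact fr_eqv_sym : symmetric fr_eqv.
Proof.
suff sym p q : fr_eqv p q -> fr_eqv q p by move=> p q; apply/idP/idP; apply: sym.
move=> /asboolP[eqpq [e he]]; apply/asboolP; split; first exact: esym.
by exists (tn_inv e) => i /=; rewrite -he -cmpA invmVK cmpm1.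
Qed.

Fact fr_eqv_trans : transitive fr_eqv.
Proof.
move=> q p r /asboolP[pq [e he]] /asboolP[qr [d hd]]; apply/asboolP; split.
  exact: etrans pq qr.
by exists (tn_comp d e) => i /=; rewrite cmpA hd.
Qed.

HB.instance Definition _ := gen_eqMixin frpair.
HB.instance Definition _ := gen_choiceMixin frpair.
Canonical fr_equiv_rel := EquivRel fr_eqv fr_eqv_refl fr_eqv_sym fr_eqv_trans.

Definition Pi_fr := {eq_quot fr_equiv_rel}.

Definition fr_class (p : frpair) : Pi_fr := \pi_Pi_fr p.
Definition fr_repr (x : Pi_fr) : frpair := generic_quotient.repr x.

Lemma fr_reprK x : fr_class (fr_repr x) = x.
Proof. exact: reprK. Qed.

Lemma fr_classP p q :
  fr_class p = fr_class q <->
  sf_gal p = sf_gal q /\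
  exists e : tnatiso p q,
    forall i, fr_frame q i ∘ e (irr_obj i) = fr_frame p i.
Proof.
by rewrite /fr_class; split=> [/eqmodP/asboolP // | h]; apply/eqmodP/asboolP.
Qed.

Definition Pi_fr_mul (x y : Pi_fr) : Pi_fr :=
  fr_class (fr_comp (fr_repr x) (fr_repr y)).

Lemma Pi_fr_mul_class p q :
  Pi_fr_mul (fr_class p) (fr_class q) = fr_class (fr_comp p q).
Proof.
have [ep [dp hp]] := (fr_classP _ _).1 (fr_reprK (fr_class p)).
have [eq [dq hq]] := (fr_classP _ _).1 (fr_reprK (fr_class q)).
apply/fr_classP; rewrite /= ep eq; split=> //; exists (tn_hcomp dp dq) => i /=.
rewrite -hp -hq fmap_cmp -!cmpA; congr (_ ∘ _).
by rewrite !cmpA (tn_nat dp).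
Qed.

Definition fr_forget (x : Pi_fr) : Pi_sf := sf_class (fr_repr x).

Lemma fr_forget_class p : fr_forget (fr_class p) = sf_class p.
Proof.
have [ep [dp _]] := (fr_classP _ _).1 (fr_reprK (fr_class p)).
by apply/sf_classP.
Qed.

(* C being split, a natural automorphism of the identity functor amounts to a
   family of nonzero scalars indexed by Irr(C). *)
Notation Aut_id := {ffun irr C -> munit L}.

Definition Aut_tens (u : Aut_id) : bool :=
  `[<exists e : tnatiso (tf_id C) (tf_id C),
       forall i, e (irr_obj i) = uval (u i) *: idm (irr_obj i)>].

Fact Aut_tens_closed : zmod_closed Aut_tens.
Proof.
split=> [|u v /asboolP[e he] /asboolP[d hd]]; apply/asboolP.
  by exists (tn_id _) => i; rewrite !ffunE scale1r.
exists (tn_comp e (tn_inv d)) => i /=; apply: (iso_epic (tn_iso d _)).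
rewrite -cmpA invmK hd he cmpm1 /= !ffunE uvalD uvalN cmpZr cmpm1 scalerA.
by rewrite mulrC divfK ?uval_neq0.
Qed.
HB.instance Definition _ :=
  GRing.isZmodClosed.Build _ Aut_tens Aut_tens_closed.

Definition B_tens : zmodClosed Aut_id := GRing.ZmodClosed.clone _ Aut_tens _.

Definition Q : zmodType := Quotient.quot B_tens.
Definition Q_class (u : Aut_id) : Q := \pi_(Quotient.quot B_tens) u.
Definition Q_repr (x : Q) : Aut_id :=
  generic_quotient.repr (x : Quotient.quot B_tens).

Lemma Q_reprK x : Q_class (Q_repr x) = x.
Proof. exact: reprK. Qed.

Lemma Q_classB u v : Q_class (u - v) = Q_class u - Q_class v.
Proof. exact: (raddfB \pi_(Quotient.quot B_tens)). Qed.

Lemma Q_classP u v : reflect (Q_class u = Q_class v) (Aut_tens (u - v)).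
Proof.
by apply: (iffP idP) => [|/eqP]; [move=> h; apply/eqP|];
   rewrite -Quotient.idealrBE.
Qed.

Definition Aut_act (s : gal_of {:L}) (u : Aut_id) : Aut_id :=
  [ffun i => munit_act s (u i)].


Lemma sf_fmapZ (p : sfpair) (X Y : C) a (f : hom X Y) :
  fmap p (a *: f) = sf_gal p a *: fmap p f.
Proof.
have p0 : fmap p (0 : hom X Y) = 0.
  have := (twist_linearP _ _).1 (sf_lin p) X Y 1 0 0.
  rewrite scaler0 addr0 rmorph1 scale1r => /(congr1 (fun x => x - fmap p 0)).
  by rewrite subrr addrK.
by have := (twist_linearP _ _).1 (sf_lin p) X Y a f 0; rewrite p0 !addr0.
Qed.

(* Aut_tens is stable under the action of s as soon as there is a pair over s:
   transport a monoidal automorphism of the identity along it. *)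
Section AutTensAct.
Variables (p : sfpair) (e : tnatiso (tf_id C) (tf_id C)).

Let cj (Y A : C) (c : hom (p Y) A) (h : is_iso c) : hom A A :=
  c ∘ fmap p (e Y) ∘ invm h.

Let cjE (Y A : C) (c : hom (p Y) A) (h : is_iso c) :
  cj h ∘ c = c ∘ fmap p (e Y).
Proof. by rewrite /cj -cmpA invmK cmpm1. Qed.

Let cj_nat (Y Z A B : C) (c : hom (p Y) A) (d : hom (p Z) B)
    (hc : is_iso c) (hd : is_iso d) (f : hom A B) :
  cj hd ∘ f = f ∘ cj hc.
Proof.
apply: (iso_epic hc); rewrite -[LHS]cmpA -[RHS]cmpA cjE.
have [k _ kK] := (sf_equiv p).1 Y Z.
have <- : d ∘ fmap p (k (invm hd ∘ (f ∘ c))) = f ∘ c.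
  by rewrite kK cmpA invmVK cmp1m.
rewrite cmpA cjE -[LHS]cmpA -fmap_cmp.
set m := k _; have := tn_nat e m; rewrite /= => ->.
by rewrite fmap_cmp cmpA /m kK !cmpA invmVK cmp1m.
Qed.

Let src (A : C) : C := sval (cid ((sf_equiv p).2 A)).
Let src_ex (A : C) : exists c : hom (p (src A)) A, is_iso c.
Proof. exact: svalP (cid ((sf_equiv p).2 A)). Qed.
Let cov (A : C) : hom (p (src A)) A := sval (cid (src_ex A)).
Let cov_iso (A : C) : is_iso (cov A) := svalP (cid (src_ex A)).

Let tr (A : C) : hom A A := cj (cov_iso A).

Let trE (Y A : C) (c : hom (p Y) A) :
  is_iso c -> tr A ∘ c = c ∘ fmap p (e Y).
Proof.
by move=> h; have := cj_nat h (cov_iso A) (idm A);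
   rewrite cmpm1 cmp1m /tr => ->; rewrite cjE.
Qed.

Program Definition tn_transport : tnatiso (tf_id C) (tf_id C) :=
  @TNatIso L C (tf_id C) (tf_id C) tr _ _ _ _.
Next Obligation.
apply: iso_cmp (iso_cmp (cov_iso X) (fmap_iso p _)) (iso_invm _).
exact: (tn_iso e).
Qed.
Next Obligation.
rewrite cmpm1 cmp1m; set i := tensm_iso (cov_iso X) (cov_iso Y).
have hc := iso_cmp i (iso_invm (fmu_iso p (src X) (src Y))).
apply: (iso_epic hc); rewrite trE //.
apply: (iso_epic (fmu_iso p (src X) (src Y))).
rewrite -!cmpA invmK cmpm1; have := tn_mu e (src X) (src Y).
rewrite /= cmpm1 cmp1m => ->; rewrite -fmu_nat.
rewrite (cmpA (invm _)) invmK cmp1m -!tensm_cmp.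
by rewrite !trE.
Qed.
Next Obligation.
rewrite cmpm1; have hc := iso_invm (feps_iso p).
apply: (iso_epic hc); rewrite trE //; have := tn_eps e.
by rewrite /= cmpm1 => ->; rewrite fmap1 cmpm1 cmp1m.
Qed.

Lemma tn_transport_scalar (X : C) (a : L) : simple X ->
  e X = a *: idm X -> tn_transport X = sf_gal p a *: idm X.
Proof.
move=> sX eX; have [c hc] := sf_fix p sX; apply: (iso_epic hc).
by rewrite /= trE // eX sf_fmapZ fmap1 cmpZr cmpZl cmpm1 cmp1m.
Qed.

End AutTensAct.

Lemma Aut_tens_act (p : sfpair) u :
  Aut_tens u -> Aut_tens (Aut_act (sf_gal p) u).
Proof.
move=> /asboolP[e he]; apply/asboolP; exists (tn_transport p e) => i.
by rewrite (tn_transport_scalar p (irr_simple i) (he i)) ffunE.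
Qed.

Lemma Aut_actB s u v : Aut_act s (u - v) = Aut_act s u - Aut_act s v.
Proof. by apply/ffunP=> i; rewrite !ffunE; exact: (@gm_actB K L (munit_mod L)). Qed.

Section Obstruction.
Variable Phi : sf_section.

Definition Q_act (s : gal_of {:L}) (x : Q) : Q := Q_class (Aut_act s (Q_repr x)).

Lemma Q_act_class s u : Q_act s (Q_class u) = Q_class (Aut_act s u).
Proof.
apply/Q_classP; rewrite -Aut_actB.
have <- : sf_gal (sf_repr (Phi s)) = s by exact: secK.
by apply: Aut_tens_act; apply/Q_classP; rewrite Q_reprK.
Qed.

Program Definition Q_mod : galmod L := @GalMod K L Q Q_act _ _ _.
Next Obligation.
rewrite -(Q_reprK x) -(Q_reprK y) -Q_classB !Q_act_class -Q_classB.
by rewrite Aut_actB.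
Qed.
Next Obligation.
rewrite -(Q_reprK x) Q_act_class; congr Q_class; apply/ffunP=> i.
by rewrite ffunE; exact: (@gm_act1 K L (munit_mod L)).
Qed.
Next Obligation.
rewrite -(Q_reprK x) !Q_act_class; congr Q_class; apply/ffunP=> i.
by rewrite !ffunE; exact: (@gm_actM K L (munit_mod L)).
Qed.

End Obstruction.

Program Definition fr_scalar (u : Aut_id) : frpair :=
  @FrPair sf_id (fun i => uval (u i) *: idm (irr_obj i)) _.
Next Obligation.
exists ((uval (u i))^-1 *: idm (irr_obj i)).
rewrite !(cmpZl, cmpZr) cmp1m !scalerA mulfV ?mulVf ?uval_neq0 //.
by rewrite scale1r.
Qed.

Definition Q_inj (x : Q) : Pi_fr := fr_class (fr_scalar (Q_repr x)).

Lemma Q_inj_class u : Q_inj (Q_class u) = fr_class (fr_scalar u).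
Proof.
have /Q_classP/asboolP[e he] := Q_reprK (Q_class u).
apply/fr_classP; split=> //; exists e => i; rewrite /= (he i) cmpZl cmpZr.
rewrite cmp1m scalerA; congr (_ *: _); rewrite !ffunE uvalD uvalN.
by rewrite mulrC divfK ?uval_neq0.
Qed.

End Pi.

Section Lambda.
Variables (K : fieldType) (L : splittingFieldType K) (C : fusion L).
Variables (Xs : seq (simple_obj C)) (Z : simple_obj C).

(* Additive notation for u_Z / (u_{X_1} ... u_{X_r}). *)
Definition lambda_val (u : {ffun irr C -> munit L}) : munit L :=
  u (irr_class Z) - \sum_(X <- Xs) u (irr_class X).

Lemma lambda_valB u v : lambda_val (u - v) = lambda_val u - lambda_val v.
Proof.
rewrite /lambda_val.
have -> : \sum_(X <- Xs) (u - v) (irr_class X)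
    = \sum_(X <- Xs) u (irr_class X) - \sum_(X <- Xs) v (irr_class X).
  by rewrite -sumrB; apply: eq_bigr => X _; rewrite !ffunE.
by rewrite !ffunE !opprD addrACA.
Qed.

Lemma lambda_val_act s u : lambda_val (Aut_act s u) = munit_act s (lambda_val u).
Proof.
pose A := @gm_act K L (munit_mod L) s; rewrite -[munit_act s]/A.
rewrite /lambda_val [RHS](@gm_actB K L (munit_mod L)) !ffunE; congr (_ - _).
elim: Xs => [|X r IH]; first by rewrite !big_nil [RHS](@gm_act0 K L (munit_mod L)).
by rewrite !big_cons [RHS](@gm_actD K L (munit_mod L)) IH ffunE.
Qed.

Section Scalars.
Variables (u : {ffun irr C -> munit L}) (e : tnatiso (tf_id C) (tf_id C)).
Hypothesis eu : forall i, e (irr_obj i) = uval (u i) *: idm (irr_obj i).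

Let e_simple (X : simple_obj C) : e X = uval (u (irr_class X)) *: idm (so_obj X).
Proof.
rewrite /irr_class; case: (cid _) => i [f fi] /=; apply: (iso_monic fi).
by have := tn_nat e f; rewrite /= => <-; rewrite eu cmpZl cmpZr cmp1m cmpm1.
Qed.

Let e_tens_from (A : C) (a : munit L) s : e A = uval a *: idm A ->
  let b := a + \sum_(X <- s) u (irr_class X) in
  let B := tens_from A [seq so_obj X | X <- s] in
  e B = uval b *: idm B.
Proof.
elim: s A a => [|X s IH] A a eA b B.
  by rewrite /b big_nil addr0.
rewrite /b big_cons addrA; apply: IH.
have -> : e (A ⊗ X) = e A ⊗ₘ e X.
  by have := tn_mu e A X; rewrite /= cmpm1 cmp1m.
rewrite eA e_simple uvalD.
by rewrite tensmZl tensmZr scalerA tensm1.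
Qed.

Let e_tens_seq s :
  let b := \sum_(X <- s) u (irr_class X) in
  let B := tens_seq [seq so_obj X | X <- s] in
  e B = uval b *: idm B.
Proof.
case: s => [|X s] b B.
  by rewrite /b big_nil scale1r; have := tn_eps e; rewrite /= cmpm1.
by rewrite /b big_cons; apply: e_tens_from.
Qed.

Lemma lambda_val_scalars : (0 < fusion_mult Xs Z)%N -> lambda_val u = 0.
Proof.
rewrite lt0n dimv_eq0 -vpick0; set h := vpick _ => h0.
apply/eqP; rewrite subr_eq0; apply/eqP/val_inj; rewrite /=.
have := tn_nat e h; rewrite /= e_simple e_tens_seq cmpZl cmpZr cmp1m cmpm1.
by move/eqP; rewrite -subr_eq0 -scalerBl scaler_eq0 (negPf h0) orbF subr_eq0 => /eqP.
Qed.

End Scalars.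

Hypothesis N_gt0 : (0 < fusion_mult Xs Z)%N.

Definition lambda_fun (x : Q C) : munit L := lambda_val (Q_repr x).

Lemma lambda_fun_class u : lambda_fun (Q_class u) = lambda_val u.
Proof.
have /Q_classP/asboolP[e he] := Q_reprK (Q_class u).
by apply/eqP; rewrite -subr_eq0 -lambda_valB (lambda_val_scalars he).
Qed.

Program Definition lambda (Phi : sf_section C) :
  galmod_hom (Q_mod Phi) (munit_mod L) := @GalModHom K L _ _ lambda_fun _ _.
Next Obligation.
by rewrite -(Q_reprK x) -(Q_reprK y) -Q_classB !lambda_fun_class lambda_valB.
Qed.
Next Obligation.
rewrite -(Q_reprK x) [Q_act _ _]Q_act_class // !lambda_fun_class.
exact: lambda_val_act.
Qed.

End Lambda.

Section Classes.
Variables (K : fieldType) (L : splittingFieldType K) (C : fusion L).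
Variable Phi : sf_section C.

Definition is_Omega (c : H2 (Q_mod Phi)) : Prop :=
  exists (lift : gal_of {:L} -> Pi_fr C) (b : Z2 (Q_mod Phi)),
    [/\ forall s, fr_forget (lift s) = Phi s,
        forall s t, Pi_fr_mul (lift s) (lift t) =
          Pi_fr_mul (Q_inj (b (s, t))) (lift (gmul s t))
      & c = H2_class b].

(* If C is split, is_Omega holds of exactly one class; 0 is a junk value. *)
Definition Omega : H2 (Q_mod Phi) := xget 0 is_Omega.

(* The identity morphism, at two propositionally equal objects. *)
Definition idcast (A B : C) (e : A = B) : hom A B :=
  let: erefl := e in idm A.

Record coherent := Coherent {
  co_rep : gal_of {:L} -> sfpair C;
  co_rep_class : forall s, sf_class (co_rep s) = Phi s;
  co_rep1 : co_rep 1%g = sf_id C;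
  co_J : forall s t,
    tnatiso (tf_comp (co_rep s) (co_rep t)) (co_rep (gmul s t));
  co_J1l : forall s X, exists e, co_J 1%g s X = idcast e;
  co_J1r : forall s X, exists e, co_J s 1%g X = idcast e;
  co_JA : forall s t r X,
    idcast (congr1 (fun g => co_rep g X) (esym (gmulA s t r)))
      ∘ (co_J (gmul s t) r X ∘ co_J s t (co_rep r X))
    = co_J s (gmul t r) X ∘ fmap (co_rep s) (co_J t r X)
}.

Definition is_beta (J : coherent) (X : simple_obj C) (c : H2 (munit_mod L)) :
    Prop :=
  exists (f : forall s, hom (co_rep J s X) X) (b : Z2 (munit_mod L)),
    [/\ forall s, is_iso (f s),
        forall s t, f s ∘ fmap (co_rep J s) (f t) =
          uval (b (s, t)) *: (f (gmul s t) ∘ co_J J s t X)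
      & c = H2_class b].

(* If C is split, is_beta holds of exactly one class; 0 is a junk value. *)
Definition beta (J : coherent) (X : simple_obj C) : H2 (munit_mod L) :=
  xget 0 (is_beta J X).

End Classes.

(* Main.v *)
From HB Require Import structures.
From mathcomp Require Import all_boot all_order all_algebra all_fingroup all_field.
From mathcomp Require Import ring boolp classical_sets.
Require Import Defs.

(* A framed pair p over s acts s-semilinearly on V = Hom(X_1 ⊗ ... ⊗ X_r, Z):
   apply the functor to h and transport source and target back along the frames
   and the tensor structure. This action is multiplicative in p, depends only on
   the class of p, and is multiplication by lambda(u) on the image of u in Q.
   Hence lifts of the Phi(s) give semilinear operators on V whose cocycle is
   lambda_*(b), so that lambda_* Omega is split by an n-dimensional twisted
   representation; frames on a coherent structure give operators which differ
   from these by scalars and whose cocycle is b_Z - \sum_i b_{X_i}.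

   The index of the class of a cocycle d divides the dimension of any d-twisted
   representation V: if D is the commutant of a d-twisted W, then by Galois
   descent dim_K D = (dim W)^2 and D acts on the intertwiners from V to W, a
   K-space of dimension (dim V)(dim W). The index exists because the commutant
   of a d-twisted representation of least dimension is a division algebra. *)

Set Implicit Arguments.
Unset Strict Implicit.
Unset Printing Implicit Defensive.

Import GRing.Theory.
Local Open Scope ring_scope.
Local Open Scope cat_scope.

(** Each vector is kept when it lies outside the span of those after it. This serves to choose a
    basis among the traces in [descent_basis]. *)
Lemma span_subbasis (F : fieldType) (V : vectType F) (X : seq V) :
  exists2 Y : seq V, {subset Y <= X} & basis_of <<X>> Y.
Proof.
elim: X => [|x X [Y sYX /andP[/eqP eY fY]]].
  by exists [::] => //; rewrite span_nil nil_basis.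
have [xX | nxX] := boolP (x \in <<X>>%VS).
  exists Y => [y /sYX|]; first by rewrite inE orbC => ->.
  rewrite /basis_of fY andbT eY span_cons eq_sym.
  by apply/eqP/addv_idPr; rewrite -memvE.
exists (x :: Y) => [y|].
  by rewrite !inE => /predU1P[->|/sYX ->]; rewrite ?eqxx ?orbT.
by rewrite /basis_of free_cons eY nxX fY !span_cons eY eqxx.
Qed.

(** * Twisted semilinear representations *)

Section TwistedRep.
Variables (K : fieldType) (L : splittingFieldType K).
Local Notation G := (gal_of {:L}).
Implicit Type d : G -> G -> munit L.

(** Invertibility of the operators is encoded by [tw_op1]: with [tw_opM] it makes [tw_op s^-1] an
    inverse of [tw_op s] up to a nonzero scalar. The function 0, which is the scalar 1 written
    additively, gives the untwisted representations. *)
Record twrep d := TwRep {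
  tw_car :> vectType L;
  tw_op : G -> tw_car -> tw_car;
  tw_semilin : forall s a v w,
    tw_op s (a *: v + w) = s a *: tw_op s v + tw_op s w;
  tw_op1 : forall v, tw_op 1%g v = uval (d 1%g 1%g) *: v;
  tw_opM : forall s t v,
    tw_op s (tw_op t v) = uval (d s t) *: tw_op (gmul s t) v
}.

Lemma gmulV (s : G) : gmul s s^-1%g = 1%g. Proof. exact: mulVg. Qed.
Lemma gmulVl (s : G) : gmul s^-1%g s = 1%g. Proof. exact: mulgV. Qed.
Lemma gmul1 (s : G) : gmul s 1%g = s. Proof. exact: mul1g. Qed.
Lemma gmul1l (s : G) : gmul 1%g s = s. Proof. exact: mulg1. Qed.

Section Operators.
Variables (d : G -> G -> munit L) (V : twrep d).

Lemma tw_op0 s : tw_op s (0 : V) = 0.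
Proof.
have := tw_semilin s 1 (0 : V) 0; rewrite scaler0 addr0 rmorph1 scale1r.
by move/(congr1 (fun x => x - tw_op s 0)); rewrite subrr addrK => <-.
Qed.

Lemma tw_opZ s a (v : V) : tw_op s (a *: v) = s a *: tw_op s v.
Proof. by have := tw_semilin s a v 0; rewrite tw_op0 !addr0. Qed.

Lemma tw_opD s (v w : V) : tw_op s (v + w) = tw_op s v + tw_op s w.
Proof. by have := tw_semilin s 1 v w; rewrite rmorph1 !scale1r. Qed.

Lemma tw_opB s (v w : V) : tw_op s (v - w) = tw_op s v - tw_op s w.
Proof. by rewrite tw_opD -scaleN1r tw_opZ rmorphN1 scaleN1r. Qed.

Lemma tw_op_sum s I (r : seq I) (f : I -> V) :
  tw_op s (\sum_(i <- r) f i) = \sum_(i <- r) tw_op s (f i).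
Proof.
elim: r => [|i r IH]; first by rewrite !big_nil tw_op0.
by rewrite !big_cons tw_opD IH.
Qed.

(** The scalar comes from T_s T_{s^-1} = d(s, s^-1) T_1 = d(s, s^-1) d(1, 1). It may be divided out
    before T_{s^-1} is applied because T_s T_{s^-1} is L-linear. *)
Definition tw_inv s (v : V) : V :=
  tw_op s^-1%g ((uval (d s s^-1%g) * uval (d 1%g 1%g))^-1 *: v).

Lemma tw_invK s v : tw_op s (tw_inv s v) = v.
Proof.
rewrite tw_opM gmulV tw_op1 !scalerA mulfV ?scale1r //.
by rewrite mulf_neq0 ?uval_neq0.
Qed.

Lemma tw_op_inj s : injective (@tw_op d V s).
Proof.
move=> v w /(congr1 (tw_op s^-1%g)); rewrite !tw_opM.
rewrite gmulVl !tw_op1 !scalerA.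
by move=> h; apply: scalerI h; rewrite mulf_neq0 ?uval_neq0.
Qed.

Lemma tw_opK s v : tw_inv s (tw_op s v) = v.
Proof. by apply: (@tw_op_inj s); rewrite tw_invK. Qed.

Lemma tw_op_bij s : bijective (@tw_op d V s).
Proof. by exists (tw_inv s); [exact: tw_opK | exact: tw_invK]. Qed.

End Operators.

Section Inj.
Variables (d : G -> G -> munit L) (V : vectType L) (T : G -> V -> V).
Hypothesis T_semilin : forall s a v w, T s (a *: v + w) = s a *: T s v + T s w.
Hypothesis T_inj : forall s, injective (T s).
Hypothesis T_mul :
  forall s t v, T s (T t v) = uval (d s t) *: T (gmul s t) v.

(** T_1 is L-linear, so T_1 T_1 v = d(1, 1) T_1 v = T_1 (d(1, 1) v), and injectivity cancels T_1. *)
Fact twrep_inj_subproof v : T 1%g v = uval (d 1%g 1%g) *: v.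
Proof.
have T0 : T 1%g 0 = 0.
  have := T_semilin 1%g 1 0 0; rewrite scaler0 addr0 rmorph1 scale1r.
  by move/(congr1 (fun x => x - T 1%g 0)); rewrite subrr addrK => <-.
apply: (@T_inj 1%g); rewrite T_mul gmul1.
by have := T_semilin 1%g (uval (d 1%g 1%g)) v 0; rewrite T0 !addr0 gal_id.
Qed.

Definition twrep_inj := TwRep T_semilin twrep_inj_subproof T_mul.

End Inj.

(** * Galois descent for semilinear actions *)

Section Descent.
Variable V : twrep (fun _ _ => 0).

Let tr (v : V) := \sum_s tw_op s v.

Let tr_fixed s v : tw_op s (tr v) = tr v.
Proof.
rewrite /tr tw_op_sum; have h : injective (gmul s).
  by move=> t u; apply: mulIg.
rewrite [RHS](reindex_inj h) /=; apply: eq_bigr => t _.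
by rewrite tw_opM scale1r.
Qed.

(** By independence of automorphisms there are w_j such that the matrix of the s(w_j) is invertible;
    every v is then an L-combination of the invariant traces of the w_j v. A basis is extracted from
    such traces. *)
Lemma descent_basis : exists2 b : (\dim {:V}).-tuple V,
  basis_of {:V} b & forall s i, tw_op s b`_i = b`_i.
Proof.
pose A : {set G} := [set: G]; have AT s : s \in A by rewrite inE.
have [w _ [Mu _ _]] := gal_matrix A.
pose X := [seq tr (a *: v) | a <- w, v <- vbasis {:V}].
have spanX : <<X>>%VS = fullv.
  apply/eqP; rewrite eqEsubv subvf /= -(span_basis (vbasisP {:V})).
  apply/span_subvP => v vV.
  pose M := \matrix_(i, j < #|A|) (enum_val i : G) (tnth w j).
  pose k (s : G) : 'I_#|A| := enum_rank_in (AT 1%g) s.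
  have kK s : enum_val (k s) = s by rewrite enum_rankK_in ?AT.
  (* The column [c] solves sum_j s(w_j) c_j = [s = 1], so that sum_j c_j tr(w_j v) collapses to T_1
     v = v. *)
  pose c := invmx M *m delta_mx (k 1%g) (0 : 'I_1).
  have cE i : \sum_j (enum_val i : G) (tnth w j) * c j 0 = (i == k 1%g)%:R.
    have /(congr1 (fun N : 'cV_ _ => N i 0)) :=
      mulKVmx Mu (delta_mx (k 1%g) (0 : 'I_1)).
    rewrite mxE [RHS]mxE eqxx andbT => <-.
    by apply: eq_bigr => j _; rewrite [M i j]mxE.
  suff -> : v = \sum_j c j 0 *: tr (tnth w j *: v).
    apply: memv_suml => j _; apply: memvZ; apply: memv_span.
    by apply/allpairsP; exists (tnth w j, v); rewrite mem_tnth.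
  under eq_bigr => j _.
    rewrite /tr scaler_sumr; under eq_bigr => s _ do rewrite tw_opZ scalerA.
    over.
  rewrite exchange_big /= (eq_bigr (fun s : G => (s == 1%g)%:R *: tw_op s v)).
    rewrite (bigD1 (1%g : G)) //= eqxx scale1r tw_op1 scale1r big1 ?addr0 //.
    by move=> s /negPf ->; rewrite scale0r.
  move=> s _; rewrite -scaler_suml; congr (_ *: _).
  have := cE (k s); rewrite kK (inj_eq (can_inj kK)).
  by move=> <-; apply: eq_bigr => j _; rewrite mulrC.
have [Y sYX bY] := span_subbasis X; rewrite spanX in bY.
have fY s i : tw_op s Y`_i = Y`_i.
  have [lti|lei] := ltnP i (size Y); last by rewrite nth_default ?tw_op0.
  have /allpairsP[[a v] [_ _ ->]] := sYX _ (mem_nth 0 lti).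
  exact: tr_fixed.
have szY : size Y == \dim {:V} by rewrite (size_basis (X := in_tuple Y) bY).
by exists (Tuple szY).
Qed.

End Descent.

End TwistedRep.

(** * Intertwiners and their dimension over K *)

Section Intertwiners.
Variables (K : fieldType) (L : splittingFieldType K).
Local Notation G := (gal_of {:L}).
Implicit Type d : G -> G -> munit L.

Section HomRep.
Variables (d : G -> G -> munit L) (V W : twrep d).

Definition hom_fun s (f : 'Hom(V, W)) (v : V) : W := tw_op s (f (tw_inv s v)).

Fact hom_fun_linear s f : linear (hom_fun s f).
Proof.
move=> a v w; rewrite /hom_fun; apply: (@tw_op_inj _ _ _ W s^-1%g).
have tw_inv_lin : tw_inv s (a *: v + w) = s^-1%g a *: tw_inv s v + tw_inv s w.
  by rewrite /tw_inv scalerDr scalerA mulrC -scalerA tw_semilin.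
rewrite tw_inv_lin linearP tw_semilin -gmulE gmulV gal_id.
by rewrite !tw_opD !tw_opZ.
Qed.
HB.instance Definition _ s f :=
  GRing.isLinear.Build L V W _ (hom_fun s f) (hom_fun_linear s f).

Definition hom_op s (f : 'Hom(V, W)) : 'Hom(V, W) := linfun (hom_fun s f).

Lemma hom_opE s f v : hom_op s f (tw_op s v) = tw_op s (f v).
Proof. by rewrite lfunE /= /hom_fun tw_opK. Qed.

Lemma hom_opP s (f g : 'Hom(V, W)) :
  (forall v, g (tw_op s v) = tw_op s (f v)) -> hom_op s f = g.
Proof. by move=> h; apply/lfunP => v; rewrite -(tw_invK s v) hom_opE h. Qed.

(** Conjugation by operators with the same cocycle on source and target cancels [d], so descent
    applies to Hom(V, W). The fixed vectors are the intertwiners. *)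
Program Definition hom_rep : twrep (fun _ _ => 0) :=
  @TwRep K L _ 'Hom(V, W) hom_op _ _ _.
Next Obligation.
apply: hom_opP => u; rewrite !add_lfunE !scale_lfunE !hom_opE.
by rewrite tw_semilin.
Qed.
Next Obligation.
by rewrite scale1r; apply: hom_opP => u; rewrite !tw_op1 linearZ.
Qed.
Next Obligation.
rewrite scale1r; apply/esym/hom_opP => u; apply: (scalerI (uval_neq0 (d s t))).
by rewrite -linearZ /= -!tw_opM !hom_opE.
Qed.

End HomRep.

End Intertwiners.

Section Intertwiners.
Variables (K : fieldType) (L : splittingFieldType K).
Local Notation G := (gal_of {:L}).
Implicit Type d : G -> G -> munit L.

(** The coordinate along the free family 1 is a K-linear retraction of the inclusion of K in L. It
    is used to read off elements of L known to lie in K. *)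
Definition scalar_part (a : L) : K := coord [tuple (1 : L)] 0 a.

Lemma scalar_part_alg k : scalar_part k%:A = k.
Proof.
rewrite /scalar_part linearZ /=.
have /(coord_free 0 0) /= : free [tuple (1 : L)] by rewrite seq1_free oner_neq0.
by move=> ->; rewrite mulr1.
Qed.

Lemma scalar_partP k a b :
  scalar_part (k *: a + b) = k * scalar_part a + scalar_part b.
Proof. by rewrite /scalar_part linearP. Qed.

Lemma scalar_partK : galois 1 {:L} ->
  forall a : L, (forall s : G, s a = a) -> (scalar_part a)%:A = a.
Proof.
move=> /galois_fixedField galL a fix_a.
have : a \in (1%VS : {vspace L}).
  by rewrite -galL; apply/fixedFieldP; rewrite ?memvf.
case/vlineP => k ->; by rewrite scalar_part_alg.
Qed.

Section Space.
Variables (galL : galois 1 {:L}) (d : G -> G -> munit L) (V W : twrep d).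

Definition is_intertw (f : 'Hom(V, W)) : bool :=
  `[<forall s v, tw_op s (f v) = f (tw_op s v)>].

(* The parameter galL is what makes this a finite dimensional K-space. *)
Record intertw (galL : galois 1 {:L}) :=
  Intertw { int_val :> 'Hom(V, W); int_valP : is_intertw int_val }.
HB.instance Definition _ := [isSub for @int_val galL].
HB.instance Definition _ := [Choice of intertw galL by <:].

Lemma int_comm (f : intertw galL) s v : tw_op s (f v) = f (tw_op s v).
Proof. by have /asboolP := int_valP f. Qed.

Fact is_intertw_closed : zmod_closed is_intertw.
Proof.
split=> [|f g /asboolP If /asboolP Ig]; apply/asboolP => s v.
  by rewrite !zero_lfunE tw_op0.
by rewrite !add_lfunE !opp_lfunE tw_opB If Ig.
Qed.
HB.instance Definition _ :=
  GRing.isZmodClosed.Build _ is_intertw is_intertw_closed.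
HB.instance Definition _ := [SubChoice_isSubZmodule of intertw galL by <:].

Fact int_scale_subproof (k : K) (f : intertw galL) :
  is_intertw (k%:A *: int_val f).
Proof.
apply/asboolP => s v; rewrite !scale_lfunE tw_opZ int_comm.
by rewrite linearZ rmorph1.
Qed.
Definition int_scale (k : K) (f : intertw galL) : intertw galL :=
  Intertw galL (int_scale_subproof k f).

Program Definition int_lmod := @GRing.Zmodule_isLmodule.Build K (intertw galL)
  int_scale _ _ _ _.
Next Obligation. 
by apply: val_inj; rewrite /= scalerA -scalerAl mul1r scalerA.
Qed.
Next Obligation. by move=> f; apply: val_inj; rewrite /= !scale1r. Qed.
Next Obligation. by move=> a f g; apply: val_inj; rewrite /= scalerDr. Qed.
Next Obligation. by move=> a b; apply: val_inj; rewrite /= !scalerDl. Qed.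
HB.instance Definition _ := int_lmod.

Lemma int_inj : injective (@int_val galL).
Proof. exact: val_inj. Qed.

Lemma intertw_basis : exists2 b : (\dim {:'Hom(V, W)}).-tuple 'Hom(V, W),
  basis_of {:'Hom(V, W)} b & forall i, is_intertw b`_i.
Proof.
have [b bB fixb] := descent_basis (hom_rep V W); exists b => // i.
by apply/asboolP => s v; rewrite -{2}(fixb s i) hom_opE.
Qed.

(** In an L-basis of Hom(V, W) made of intertwiners, the intertwiners are exactly the combinations
    with coefficients in K. *)
Lemma intertw_vect :
  exists2 f : intertw galL -> 'rV[K]_(\dim {:'Hom(V, W)}),
    linear f & bijective f.
Proof.
have [b bB bI] := intertw_basis.
exists (fun f : intertw galL => \row_i scalar_part (coord b i f)).
  move=> k f g; apply/rowP => i; rewrite !mxE /= linearP /=.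
  by rewrite mulr_algl scalar_partP.
have gP (r : 'rV_(\dim {:'Hom(V, W)})) :
    is_intertw (\sum_i (r 0 i)%:A *: b`_i : 'Hom(V, W)).
  apply/asboolP => s v; rewrite !sum_lfunE tw_op_sum; apply: eq_bigr => i _.
  by have /asboolP bi := bI i; rewrite !scale_lfunE tw_opZ linearZ rmorph1 bi.
exists (fun r => Intertw galL (gP r)) => [f | r]; last first.
  apply/rowP => i; rewrite mxE coord_sum_free ?(basis_free bB) //.
  exact: scalar_part_alg.
apply: val_inj => /=; rewrite [RHS](coord_basis bB) ?memvf //.
apply: eq_bigr => i _; rewrite mxE scalar_partK // => s.
(* Conjugation by s fixes both f and the basis, and applies s to the coordinates; comparing
   coefficients shows that each coordinate is fixed. *)
have : hom_op s (int_val f) = int_val f.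
  by apply: hom_opP => v; rewrite int_comm.
rewrite {1}(coord_basis bB (memvf (int_val f))).
rewrite (_ : hom_op s = @tw_op _ _ _ (hom_rep V W) s) //.
rewrite tw_op_sum => /(congr1 (coord b i)).
rewrite (eq_bigr (fun j => s (coord b j f) *: b`_j)); last first.
  move=> j _; rewrite tw_opZ; congr (_ *: _); apply: hom_opP => v.
  by have /asboolP -> := bI j.
by rewrite coord_sum_free ?(basis_free bB).
Qed.

HB.instance Definition _ := @Lmodule_hasFinDim.Build K (intertw galL) _
  (let: exist2 f lf bf := cid2 intertw_vect in exist2 _ _ f lf bf).

Lemma dim_intertw : \dim {:intertw galL} = (\dim {:V} * \dim {:W})%N.
Proof.
have -> : \dim {:intertw galL} = \dim {:'Hom(V, W)} by rewrite dimvf.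
by rewrite !dimvf.
Qed.

End Space.

End Intertwiners.
Arguments int_val {K L d V W galL} i.

(** * The index *)

Section DivisionModule.
Variables (K : fieldType) (D : falgType K) (W : vectType K).
Variable rho : D -> 'End(W).
Hypothesis D_div : forall x : D, x != 0 -> x \is a GRing.unit.
Hypothesis rhoP : forall k x y, rho (k *: x + y) = k *: rho x + rho y.
Hypothesis rhoM : forall x y, rho (x * y) = (rho x \o rho y)%VF.
Hypothesis rho1 : rho 1 = \1%VF.

(** A proper stable subspace S grows by an orbit D w with w outside S. If x w lies in S with x
    nonzero, applying x^-1 puts w in S; so the orbit has dimension dim D and meets S in 0 only. *)
Lemma dim_division_module : (\dim {:D} %| \dim {:W})%N.
Proof.
pose orb w x : W := rho x w.
have orb_lin w : linear (orb w).
  by move=> k x y; rewrite /orb rhoP add_lfunE scale_lfunE.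
pose orbL w : {linear D -> W} :=
  HB.pack (orb w) (GRing.isLinear.Build K D W _ _ (orb_lin w)).
pose O w : {vspace W} := limg (linfun (orbL w)).
have OE w x : linfun (orbL w) x = rho x w by rewrite lfunE.
have stab_dvd (S : {vspace W}) : (forall x w, w \in S -> rho x w \in S) ->
    (\dim {:D} %| \dim S)%N -> (\dim {:D} %| \dim {:W})%N.
  have [n] := ubnP (\dim {:W} - \dim S)%N; elim: n S => // n IH S ltn stS dvdS.
  have [SW | ] := eqVneq S fullv; first by rewrite -SW.
  rewrite eqEsubv subvf /= => /subvPn[w _ wS].
  have dSO : (S :&: O w = 0)%VS.
    apply/eqP; rewrite -subv0; apply/subvP => v /memv_capP[vS /memv_imgP[x _]].
    rewrite OE => def_v; rewrite memv0 def_v.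
    have [-> | /D_div Ux] := eqVneq x 0.
      by rewrite -OE linear0.
    case/negP: wS; have -> : w = rho x^-1 v.
      by rewrite def_v -comp_lfunE -rhoM mulVr // rho1 id_lfunE.
    exact: stS.
  have dimO : \dim (O w) = \dim {:D}.
    apply: limg_dim_eq; apply/eqP; rewrite -subv0; apply/subvP => x.
    rewrite memv_cap memvf memv_ker OE memv0 /=; apply: contraLR => /D_div Ux.
    apply: contraNneq wS => rxw.
    have -> : w = rho x^-1 (rho x w).
      by rewrite -comp_lfunE -rhoM mulVr // rho1 id_lfunE.
    by rewrite rxw linear0 mem0v.
  have dimSO : \dim (S + O w)%VS = (\dim S + \dim {:D})%N.
    by rewrite -dimO dimv_disjoint_sum.
  have D0 : (0 < \dim {:D})%N.
    rewrite lt0n dimv_eq0; apply: contraNneq (oner_neq0 D) => D0.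
    by rewrite -memv0 -D0 memvf.
  apply: (IH (S + O w)%VS); last by rewrite dimSO dvdn_add.
    rewrite dimSO subnDA (leq_trans _ (_ : (\dim {:W} - \dim S) <= n)%N) //.
    rewrite ltn_subrL D0 subn_gt0 (leq_trans _ (dimvS (subvf (S + O w)%VS))) //.
    by rewrite dimSO -addn1 leq_add2l.
  move=> x _ /memv_addP[u uS [_ /memv_imgP[y _ ->] ->]].
  rewrite linearD /=; apply: memv_add; first exact: stS.
  rewrite OE -comp_lfunE -rhoM -OE.
  exact: memv_img (memvf _).
apply: (stab_dvd 0%VS) => [x w|]; last by rewrite dimv0.
by rewrite !memv0 => /eqP ->; rewrite linear0.
Qed.

End DivisionModule.

Section Subrep.
Variables (K : fieldType) (L : splittingFieldType K).
Local Notation G := (gal_of {:L}).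
Variables (d : G -> G -> munit L) (V : twrep d) (U : {vspace V}).
Hypothesis U_stable : forall s v, v \in U -> tw_op s v \in U.

Program Definition subrep : twrep d :=
  @TwRep K L d (subvs_of U) (fun s u => vsproj U (tw_op s (vsval u))) _ _ _.
Next Obligation.
by rewrite tw_semilin linearP.
Qed.
Next Obligation. by rewrite tw_op1 linearZ /= vsvalK. Qed.
Next Obligation.
by rewrite vsprojK ?U_stable ?subvsP // tw_opM linearZ.
Qed.

Lemma subrep_opE s (u : subrep) : vsval (tw_op s u) = tw_op s (vsval u).
Proof. by rewrite /= vsprojK // U_stable ?subvsP. Qed.

Lemma dim_subrep : \dim {:subrep} = \dim U.
Proof. by rewrite dimvf. Qed.

End Subrep.

(** * Commutants of twisted representations *)

Section Endomorphisms.
Variables (K : fieldType) (L : splittingFieldType K).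
Local Notation G := (gal_of {:L}).

Section Compose.
Variables (galL : galois 1 {:L}) (d : G -> G -> munit L) (U V W : twrep d).

Fact int_comp_subproof (f : intertw V W galL) (g : intertw U V galL) :
  is_intertw (int_val f \o int_val g)%VF.
Proof. by apply/asboolP => s v; rewrite !comp_lfunE !int_comm. Qed.
Definition int_comp f g : intertw U W galL :=
  Intertw galL (int_comp_subproof f g).

Fact int_id_subproof : is_intertw (\1%VF : 'Hom(V, V)).
Proof. by apply/asboolP => s v; rewrite !id_lfunE. Qed.
Definition int_id : intertw V V galL := Intertw galL int_id_subproof.

End Compose.

Section Algebra.
Variables (galL : galois 1 {:L}) (d : G -> G -> munit L) (V : twrep d).

(* The parameter V_gt0 is what makes this a nontrivial ring. *)
Definition endo (V_gt0 : (0 < \dim {:V})%N) : Type := intertw V V galL.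
Variable V_gt0 : (0 < \dim {:V})%N.
Local Notation A := (endo V_gt0).
HB.instance Definition _ := Vector.copy A (intertw V V galL).

Definition endo_mul (f g : A) : A := int_comp f g.
Definition endo_one : A := int_id galL V.

Program Definition endo_ring := @GRing.Zmodule_isNzRing.Build A
  endo_one endo_mul _ _ _ _ _ _.
Next Obligation. by move=> f g h; apply: val_inj; exact: comp_lfunA. Qed.
Next Obligation. by move=> f; apply: val_inj; exact: comp_lfun1l. Qed.
Next Obligation. by move=> f; apply: val_inj; exact: comp_lfun1r. Qed.
Next Obligation. by move=> f g h; apply: val_inj; exact: comp_lfunDl. Qed.
Next Obligation. by move=> f g h; apply: val_inj; exact: comp_lfunDr. Qed.
Next Obligation.
apply/eqP => /(congr1 int_val) /= /lfunP one0; move: V_gt0.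
rewrite lt0n dimv_eq0 -subv0 => /subvPn[v _]; rewrite memv0.
by have := one0 v; rewrite id_lfunE zero_lfunE => ->; rewrite eqxx.
Qed.
HB.instance Definition _ := endo_ring.

Lemma endo_scaleAl (k : K) (f g : A) : k *: (f * g) = (k *: f) * g.
Proof. by apply: val_inj; exact: comp_lfunZl. Qed.
HB.instance Definition _ := GRing.Lmodule_isLalgebra.Build K A endo_scaleAl.

Lemma endo_scaleAr (k : K) (f g : A) : k *: (f * g) = f * (k *: g).
Proof. by apply: val_inj; exact: comp_lfunZr. Qed.
HB.instance Definition _ := GRing.Lalgebra_isAlgebra.Build K A endo_scaleAr.
HB.instance Definition _ := Algebra_isFalgebra.Build K A.

Lemma dim_endo : \dim {:A} = (\dim {:V} ^ 2)%N.
Proof. by rewrite -mulnn -(dim_intertw galL). Qed.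

(** The intertwiners contain an L-basis of End(V), so a central f commutes with all of End(V) and is
    a scalar of L. Commuting with the semilinear operators then puts this scalar in K. *)
Lemma endo_center (f : A) :
  (forall g : A, f * g = g * f) -> exists k : K, f = k%:A.
Proof.
move=> cf.
have [b bB bI] := intertw_basis V V.
have cfE (g : 'End(V)) v : int_val f (g v) = g (int_val f v).
  rewrite (coord_basis bB (memvf g)) !sum_lfunE linear_sum /=.
  apply: eq_bigr => i _; rewrite !scale_lfunE linearZ /=; congr (_ *: _).
  have := cf (Intertw galL (bI i)); move/(congr1 int_val)/lfunP/(_ v).
  by rewrite !comp_lfunE.
have [v vN0] : exists v : V, v != 0.
  move: V_gt0; rewrite lt0n dimv_eq0 -subv0 => /subvPn[v _ v0].
  by exists v; rewrite -memv0.
pose c := coord [tuple v] 0; have cv : c v = 1.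
  by have /(coord_free 0 0) : free [tuple v] by rewrite seq1_free.
(* Commuting with the rank one map u -> c(u) w, evaluated at v where c(v) = 1, gives f w = c(f v)
   w. *)
have pr_lin (w : V) : linear (fun u => c u *: w).
  by move=> k x y; rewrite /c linearP scalerDl scalerA.
pose pr (w : V) : {linear V -> V} := HB.pack (fun u => c u *: w)
  (GRing.isLinear.Build L V V _ _ (pr_lin w)).
have fE w : int_val f w = c (int_val f v) *: w.
  by have := cfE (linfun (pr w)) v; rewrite !lfunE /= cv scale1r.
exists (scalar_part (c (int_val f v))); apply: int_inj; apply/lfunP => w.
have algE k : int_val (k%:A : A) = k%:A *: \1%VF by [].
rewrite [LHS]fE algE scale_lfunE id_lfunE; congr (_ *: _).
(* For a = c(f v), the equality T_s (f v) = f (T_s v) reads s(a) T_s v = a T_s v, with T_s v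
   nonzero. *)
rewrite scalar_partK // => s; have tv0 : tw_op s v != 0.
  apply: contraNneq vN0 => e; apply/eqP/(@tw_op_inj _ _ _ V s).
  by rewrite e tw_op0.
apply/eqP; rewrite -subr_eq0 -[_ == 0]orbF -(negPf tv0) -scaler_eq0 scalerBl.
by rewrite -tw_opZ -[_ *: tw_op s v]fE -fE int_comm subrr.
Qed.

End Algebra.
End Endomorphisms.

(** * Existence of the index *)

Section Index.
Variables (K : fieldType) (L : splittingFieldType K).
Local Notation G := (gal_of {:L}).
Hypothesis galL : galois 1 {:L}.

(** Schur's lemma: the kernel of f is a subrepresentation, so by minimality of the dimension it is
    zero or everything. *)
Lemma endo_division (d : G -> G -> munit L) (V : twrep d)
    (V_gt0 : (0 < \dim {:V})%N) :
  (forall W : twrep d, (0 < \dim {:W})%N -> (\dim {:V} <= \dim {:W})%N) ->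
  forall f : endo galL V_gt0, f != 0 -> f \is a GRing.unit.
Proof.
move=> Vmin f f0.
have kerf : lker (int_val f) == 0%VS.
  have stab s v : v \in lker (int_val f) -> tw_op s v \in lker (int_val f).
    by rewrite !memv_ker -int_comm => /eqP ->; rewrite tw_op0.
  apply: contraT; rewrite -dimv_eq0 -lt0n -(dim_subrep stab) => /Vmin.
  rewrite dim_subrep => le_V; have /eqP kerT : lker (int_val f) == fullv.
    by rewrite eqEdim subvf.
  case/eqP: f0; apply: (val_inj : injective (@int_val K L d V V galL)).
  apply/lfunP => v; rewrite zero_lfunE; apply/eqP.
  by rewrite -memv_ker kerT memvf.
have gP : is_intertw (int_val f)^-1%VF.
  apply/asboolP => s v; have /lker0P := kerf; apply.
  by rewrite -int_comm !lker0_lfunVK.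
apply/unitrP; exists (Intertw galL gP); split.
  by apply: val_inj; exact: lker0_compVf.
by apply: val_inj; exact: lker0_compfV.
Qed.

Variable d : Z2 (munit_mod L).
Local Notation dd := (fun s t => (d : {ffun _ -> _}) (s, t) : munit L).
Variables (V : twrep dd) (V_gt0 : (0 < \dim {:V})%N).

(** The witness m is the least dimension of a nonzero d-twisted representation. Its commutant is a
    division algebra of K-dimension m^2 and is the fixed algebra itself, so matrices of size 1, that
    is [k = 0], suffice. *)
Lemma is_ind_exists : exists m, is_ind (H2_class d) m.
Proof.
pose P n := `[<exists V : twrep dd, (0 < \dim {:V})%N /\ \dim {:V} = n>].
have exP : exists n, P n by exists (\dim {:V}); apply/asboolP; exists V.
case: (ex_minnP exP) => m /asboolP[V0 [V0_gt0 dimV0]] m_min.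
exists m, (endo galL V0_gt0); split; last by rewrite dim_endo dimV0.
  split; last by move=> f; apply: endo_center.
  apply: endo_division => W W_gt0; rewrite dimV0; apply: m_min.
  by apply/asboolP; exists W.
exists V0, (@tw_op _ _ _ V0), d; split=> //.
- exact: tw_semilin.
- exact: tw_op_bij.
- exact: tw_opM.
exists 0%N, (fun B => int_val (B 0 0)); split.
- split=> [A B | | A B | a A].
  + by rewrite mxE.
  + by rewrite mxE.
  + by rewrite mxE big_ord1.
  + by rewrite mxE.
- by move=> A B /val_inj AB; apply/matrixP=> i j; rewrite !ord1.
move=> A; split=> [cA | [B <-] s v]; last exact: int_comm.
have AP : is_intertw A by apply/asboolP.
by exists (const_mx (Intertw galL AP)); rewrite mxE.
Qed.

End Index.

(** * Divisibility of dimensions by the index *)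

Section Corner.
Variables (R : nzRingType) (k : nat).
Implicit Types x y : R.

(** This is x times the matrix unit e_11. [corner_mx 1] is an idempotent that cuts a copy of [R] out
    of the matrix ring, which allows passing from M_{k+1}(D) to D. *)
Definition corner_mx x : 'M[R]_k.+1 :=
  \matrix_(i, j) (x *+ ((i == 0) && (j == 0))).

Lemma mul_corner_mx (B : 'M[R]_k.+1) :
  corner_mx 1 * B * corner_mx 1 = corner_mx (B 0 0).
Proof.
apply/matrixP => i j; rewrite !mxE (bigD1 0) //= big1 => [|l /negPf l0].
  rewrite !mxE (bigD1 0) //= big1 => [|l /negPf l0].
    by rewrite !mxE eqxx andbT !addr0; case: eqP; case: eqP => *;
      rewrite ?mul1r ?mulr1 ?mul0r ?mulr0.
  by rewrite !mxE l0 andbF mul0r.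
by rewrite [corner_mx _ _ _]mxE l0 mulr0.
Qed.

Lemma corner_mxM x y : corner_mx x * corner_mx y = corner_mx (x * y).
Proof.
apply/matrixP => i j; rewrite !mxE (bigD1 0) //= big1 => [|l /negPf l0].
  by rewrite !mxE eqxx andbT addr0; case: eqP; case: eqP => *;
    rewrite ?mul0r ?mulr0.
by rewrite !mxE l0 andbF mul0r.
Qed.

End Corner.

Section Index.
Variables (K : fieldType) (L : splittingFieldType K).
Local Notation G := (gal_of {:L}).
Hypothesis galL : galois 1 {:L}.

(** As D is the commutant of W, dim_K D = (dim W)^2 and dim W = m. Postcomposition makes the
    intertwiners from V to W a D-module of K-dimension (dim V) m; this is divisible by m^2, and one
    factor m cancels. *)
Lemma dvd_dim_twrep (d : G -> G -> munit L) (V W : twrep d) (D : falgType K)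
    (rho : D -> intertw W W galL) m :
  (forall x : D, x != 0 -> x \is a GRing.unit) ->
  linear rho -> rho 1 = int_id galL W ->
  (forall x y, rho (x * y) = int_comp (rho x) (rho y)) ->
  injective rho -> (forall f, exists x, rho x = f) ->
  \dim {:D} = (m ^ 2)%N ->
  (m %| \dim {:V})%N.
Proof.
move=> divD rho_lin rho1 rhoM rho_inj rho_surj dimD.
pose rhoL : {linear D -> intertw W W galL} :=
  HB.pack rho (GRing.isLinear.Build K D (intertw W W galL) _ _ rho_lin).
have dimW : \dim {:W} = m.
  apply/eqP; rewrite -eqn_sqr -dimD -mulnn -(dim_intertw galL) eq_sym.
  apply/eqP.
  have ker0 : lker (linfun rhoL) == 0%VS.
    by apply/lker0P => x y; rewrite !lfunE; apply: rho_inj.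
  rewrite -(limg_dim_eq (f := linfun rhoL)) ?(eqP ker0) ?capv0 //.
  congr (\dim _); apply/eqP; rewrite eqEsubv subvf /=; apply/subvP => f _.
  have [x <-] := rho_surj f.
  by rewrite -[rho _]/(rhoL _) -(lfunE rhoL) memv_img ?memvf.
have comp_lin x : linear (fun f : intertw V W galL => int_comp (rho x) f).
  move=> k f g; apply: int_inj => /=.
  by rewrite comp_lfunDr -comp_lfunZr.
pose compL x : {linear intertw V W galL -> intertw V W galL} :=
  HB.pack (fun f => int_comp (rho x) f)
    (GRing.isLinear.Build K _ _ _ _ (comp_lin x)).
have := @dim_division_module K D (intertw V W galL)
  (fun x => linfun (compL x)) divD.
rewrite dim_intertw dimD dimW -mulnn => dvd.
have m_gt0 : (0 < m)%N.
  rewrite lt0n; apply/eqP => m0; move: dimD; rewrite m0 => /eqP.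
  rewrite exp0n // dimv_eq0 => /eqP D0; case/eqP: (oner_neq0 D).
  by apply/eqP; rewrite -memv0 -D0 memvf.
rewrite -(dvdn_pmul2r m_gt0); apply: dvd.
- move=> k x y; apply/lfunP => f; rewrite add_lfunE scale_lfunE !lfunE /=.
  rewrite rho_lin; apply: int_inj => /=.
  by rewrite comp_lfunDl -comp_lfunZl.
- move=> x y; apply/lfunP => f; rewrite comp_lfunE !lfunE /= rhoM.
  by apply: int_inj; rewrite /= comp_lfunA.
apply/lfunP => f; rewrite lfunE id_lfunE /= rho1.
by apply: int_inj; rewrite /= comp_lfun1l.
Qed.

Variable d : Z2 (munit_mod L).
Local Notation dd := (fun s t => (d : {ffun _ -> _}) (s, t) : munit L).

(** The algebra M_{k+1}(D) is the commutant of a representation twisted by a cocycle d' cohomologous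
    to d. Rescaling makes it d-twisted, and the image of the idempotent e_11 is a subrepresentation
    with commutant D. *)
Lemma is_ind_dvd (V : twrep dd) m : is_ind (H2_class d) m -> (m %| \dim {:V})%N.
Proof.
case=> D [[divD _] [V' [T' [d' [T'lin T'bij T'mul d'd [k [phi phiP]]]]]] dimD].
case: phiP => -[phiD phi1 phiM phiZ] phi_inj phi_im.
have /H2_classP/asboolP[h dh] := d'd.
(* The cochain [h] has coboundary d' - d, so dividing T'_s by h(s) changes the cocycle from d' to
   d. *)
pose T s v := (uval (h s))^-1 *: T' s v.
have T_lin s a v w : T s (a *: v + w) = s a *: T s v + T s w.
  by rewrite /T T'lin scalerDr !scalerA mulrC.
have T_inj s : injective (T s).
  move=> v w /(scalerI (invr_neq0 (uval_neq0 _))); exact: bij_inj (T'bij s) _ _.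
have T_mul s t v : T s (T t v) = uval (d (s, t)) *: T (gmul s t) v.
  have T0 : T s 0 = 0.
    have := T_lin s 1 0 0; rewrite scaler0 addr0 rmorph1 scale1r.
    by move/(congr1 (fun x => x - T s 0)); rewrite subrr addrK.
  have := T_lin s (uval (h t))^-1 (T' t v) 0; rewrite T0 !addr0 => ->.
  rewrite /T T'mul !scalerA; congr (_ *: _).
  have /ffunP/(_ (s, t)) := dh; rewrite !ffunE => /(congr1 (@uval L)) /=.
  move=> /(canRL (divfK (uval_neq0 _))) ->.
  have -> : s (uval (h t))^-1 = (s (uval (h t)))^-1 by rewrite fmorphV.
  have := uval_neq0 (h s); have := uval_neq0 (h (gmul s t)).
  have := uval_neq0 (munit_act s (h t)); rewrite /=.
  move: (s _) (uval (h s)) (uval (h (gmul s t))) => a b c a0 c0 b0.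
  by field; rewrite a0 b0 c0.
pose V1 : twrep dd := twrep_inj T_lin T_inj T_mul.
have V1E s v : @tw_op _ _ _ V1 s v = T s v by [].
pose e x : 'End(V') := phi (corner_mx k x).
have phiI B s (v : V1) : tw_op s (phi B v : V1) = phi B (tw_op s v).
  rewrite /= /T linearZ; congr (_ *: _).
  by move: s v; apply/phi_im; exists B.
have eM x y : e (x * y) = (e x \o e y)%VF by rewrite -phiM corner_mxM.
pose U := limg (e 1).
have eU v x : e x v \in U.
  by rewrite -[x]mul1r eM comp_lfunE memv_img ?memvf.
have eU1 v : v \in U -> e 1 v = v.
  by case/memv_imgP => u _ ->; rewrite -comp_lfunE -eM mulr1.
have stU s (v : V1) : v \in U -> tw_op s v \in U.
  by case/memv_imgP => u _ ->; rewrite phiI eU.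
pose W := subrep stU.
pose rho_hom x : 'End(W) := (linfun (vsproj U) \o e x \o linfun vsval)%VF.
have rho_homE x (w : W) : vsval (rho_hom x w) = e x (vsval w).
  by rewrite !comp_lfunE !lfunE /= vsprojK // eU.
have rhoP x : is_intertw (rho_hom x : 'Hom(W, W)).
  apply/asboolP => s w; apply: (@subvs_inj _ _ U).
  have opE := @subrep_opE K L dd V1 U stU.
  by rewrite [LHS]opE !rho_homE phiI -opE.
pose rho x : intertw W W galL := Intertw galL (rhoP x).
have e_lin a x y : e (a *: x + y) = a%:A *: e x + e y.
  rewrite -phiZ -phiD; congr phi; apply/matrixP => i j.
  by rewrite !mxE mulrnDl scalerMnr.
have rho_homP x y : rho_hom x = rho_hom y -> e x = e y.
  (* Since e x = e x o e 1, the operator e x is determined by its restriction to [U]. *)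
  move=> xy; apply/lfunP => v; rewrite -[x]mulr1 -[y]mulr1 !eM !comp_lfunE.
  have := eU v 1; move: (e 1 v) => u uU.
  have := congr1 (fun f : 'Hom(W, W) => vsval (f (vsproj U u))) xy.
  by rewrite !rho_homE vsprojK.
apply: (@dvd_dim_twrep _ V W D rho) => //.
- move=> a x y; apply: int_inj; apply/lfunP => w; apply: (@subvs_inj _ _ U).
  have -> : int_val (a *: rho x + rho y) w = a%:A *: rho_hom x w + rho_hom y w.
    by rewrite add_lfunE scale_lfunE.
  have vsvalP (u v : W) : vsval (a%:A *: u + v) = a%:A *: vsval u + vsval v.
    by [].
  rewrite vsvalP !rho_homE e_lin add_lfunE. by rewrite scale_lfunE.
- apply: int_inj; apply/lfunP => w; apply: (@subvs_inj _ _ U).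
  by rewrite [LHS]rho_homE id_lfunE eU1 ?subvsP.
- move=> x y; apply: int_inj; apply/lfunP => w; apply: (@subvs_inj _ _ U).
  have -> : int_val (int_comp (rho x) (rho y)) w = rho_hom x (rho_hom y w).
    exact: comp_lfunE.
  by rewrite !rho_homE eM comp_lfunE.
- move=> x y /(congr1 int_val)/rho_homP/phi_inj/matrixP/(_ 0 0).
  by rewrite !mxE.
move=> f.
(* For surjectivity, f is extended to V' through the idempotent e 1. The extension commutes with T',
   hence is some phi B, and [B 0 0] is the preimage of f. *)
have [g gE] : exists g : 'End(V'),
    forall v, g v = vsval (int_val f (vsproj U (e 1 v))).
  exists (linfun vsval \o int_val f \o linfun (vsproj U) \o e 1)%VF => v.
  by rewrite !comp_lfunE !lfunE.
have gI s (v : V1) : @tw_op _ _ _ V1 s (g v) = g (tw_op s v).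
  have opE := @subrep_opE K L dd V1 U stU.
  rewrite !gE -phiI -opE int_comm; congr (vsval (int_val f _)).
  by apply: (@subvs_inj _ _ U); rewrite opE !vsprojK // ?stU ?eU.
have /phi_im[B phiB] : forall s v, T' s (g v) = g (T' s v).
  move=> s v; have := gI s v; rewrite !V1E /T linearZ.
  by move/(scalerI (invr_neq0 (uval_neq0 _))).
exists (B 0 0); apply: int_inj; apply/lfunP => w; apply: (@subvs_inj _ _ U).
rewrite [LHS]rho_homE /e -mul_corner_mx !phiM phiB !comp_lfunE -/(e 1) gE.
by rewrite !eU1 ?subvsP ?vsvalK.
Qed.

End Index.

(** * Relations between classes, and the order of the class of a twisted representation *)

Section H2Facts.
Variables (K : fieldType) (L : splittingFieldType K) (M : galmod L).

Lemma H2_class0 : H2_class (0 : Z2 M) = 0.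
Proof. by have := H2_classB (0 : Z2 M) 0; rewrite !subrr. Qed.

Lemma H2_classD (c e : Z2 M) : H2_class (c + e) = H2_class c + H2_class e.
Proof.
rewrite -[e in LHS]opprK H2_classB -[- e]sub0r H2_classB H2_class0.
by rewrite sub0r opprK.
Qed.

Lemma H2_class_sum I (r : seq I) (c : I -> Z2 M) :
  H2_class (\sum_(i <- r) c i) = \sum_(i <- r) H2_class (c i).
Proof.
elim: r => [|i r IH]; first by rewrite !big_nil H2_class0.
by rewrite !big_cons H2_classD IH.
Qed.

Lemma H2_class_eqP (c e : Z2 M) (h : gal_of {:L} -> M) :
  (forall s t, c (s, t) - e (s, t) = gm_act s (h t) - h (gmul s t) + h s) ->
  H2_class c = H2_class e.
Proof.
move=> ce; apply/H2_classP/asboolP; exists [ffun s => h s].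
by apply/ffunP => -[s t]; rewrite !raddfB !ffunE /= ce.
Qed.

End H2Facts.

Section Index.
Variables (K : fieldType) (L : splittingFieldType K).
Local Notation G := (gal_of {:L}).
Variable d : Z2 (munit_mod L).
Local Notation dd := (fun s t => (d : {ffun _ -> _}) (s, t) : munit L).
Variable V : twrep dd.

(** The nonzero representation V ensures that [ind] is a true index and not its default value 0. *)
Lemma ind_dvd_dim : galois 1 {:L} -> (0 < \dim {:V})%N ->
  (ind (H2_class d) %| \dim {:V})%N.
Proof.
move=> galL V_gt0; apply: (is_ind_dvd galL).
have := is_ind_exists galL V_gt0.
exact: (@xgetPex _ 0%N (is_ind (H2_class d))).
Qed.

(** Taking determinants of the matrices M_s of T_s in a basis exhibits d^n as the coboundary of s ->
    det M_s. *)
Lemma H2_class_dim : H2_class d *+ \dim {:V} = 0.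
Proof.
set n := \dim {:V}; pose b := vbasis {:V}.
pose M s : 'M[L]_n := \matrix_(i, j) coord b j (tw_op s b`_i).
have freeb := basis_free (vbasisP {:V}).
have bM s (i : 'I_n) : tw_op s b`_i = \sum_j M s i j *: b`_j.
  rewrite [LHS](coord_vbasis (memvf _)); apply: eq_bigr => j _.
  by rewrite mxE.
(* Rows hold the coordinates of T_s b_i, and T_s applies s to the coefficients of T_t b_i; hence the
   twist of [M t] and the reversed order. *)
have MM (s t : G) : map_mx s (M t) *m M s = uval (d (s, t)) *: M (gmul s t).
  apply/matrixP => i k; rewrite mxE.
  rewrite [RHS]mxE [M (gmul s t) i k]mxE -linearZ /= -tw_opM bM tw_op_sum.
  rewrite linear_sum.
  apply: eq_bigr => j _; rewrite tw_opZ bM linearZ /= coord_sum_free //.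
  by rewrite mxE.
have detM (s t : G) : s (\det (M t)) * \det (M s)
    = uval (d (s, t)) ^+ n * \det (M (gmul s t)).
  by rewrite -det_map_mx -det_mulmx MM detZ.
have detM0 s : \det (M s) != 0.
  (* At t = s^-1 the right-hand side is nonzero, because M_1 is the scalar matrix d(1, 1). *)
  have := detM s s^-1%g; rewrite gmulV.
  have -> : M 1%g = (uval (d (1%g, 1%g)))%:M.
    apply/matrixP => i j; rewrite !mxE tw_op1 linearZ /= coord_free //.
    by rewrite mulr_natr eq_sym.
  rewrite det_scalar => /eqP; apply: contraTneq => ->.
  by rewrite mulr0 eq_sym mulf_neq0 ?expf_neq0 ?uval_neq0.
have nE (c : Z2 (munit_mod L)) k : H2_class c *+ k = H2_class (c *+ k).
  by elim: k => [|k IH]; rewrite ?mulr0n ?H2_class0 // !mulrS IH H2_classD.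
rewrite nE -(H2_class0 (munit_mod L)).
apply: (@H2_class_eqP K L (munit_mod L) (d *+ n) 0
  (fun s => MUnit (detM0 s))) => s t.
have dnE k : uval ((d *+ k) (s, t)) = uval (d (s, t)) ^+ k.
  elim: k => [|k IH]; first by rewrite ffunE.
  by rewrite mulrS ffunE uvalD IH exprS.
apply: val_inj; rewrite [LHS]/= dnE ffunE /=.
by rewrite invr1 mulr1 mulrAC detM mulfK.
Qed.

End Index.

(** * The action of framed pairs on multiplicity spaces *)

Section Frames.
Variables (K : fieldType) (L : splittingFieldType K) (C : fusion L).

Fact irr_iso_ex (X : simple_obj C) :
  exists f : hom (so_obj X) (irr_obj (irr_class X)), is_iso f.
Proof. exact: svalP (cid (irr_cover (so_simple X))). Qed.

Implicit Types (p q : frpair C) (X : simple_obj C).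

Definition irr_iso (X : simple_obj C) := sval (cid (irr_iso_ex X)).

Lemma irr_isoP X : is_iso (irr_iso X).
Proof. exact: svalP (cid (irr_iso_ex X)). Qed.

(** Frames are given on representatives only; conjugation by [irr_iso X] extends them to every
    simple object. *)
Definition frame (p : frpair C) (X : simple_obj C) : hom (p X) X :=
  invm (irr_isoP X) ∘ (fr_frame p (irr_class X) ∘ fmap p (irr_iso X)).

Lemma frame_iso p X : is_iso (frame p X).
Proof.
apply: iso_cmp (iso_invm _) (iso_cmp (fr_iso _ _) (fmap_iso _ _)).
exact: irr_isoP.
Qed.

Definition coframe p X : hom (so_obj X) (p X) := invm (frame_iso p X).

Lemma coframeK p X : frame p X ∘ coframe p X = idm _.
Proof. exact: invmVK. Qed.

(** Inverse frames of the factors are glued by the tensor constraints of [p], from left to right as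
    in [tens_from]; [k] is the map already built on the accumulated product. *)
Fixpoint coframe_from p (A : C) (k : hom A (p A)) (s : seq (simple_obj C)) :
    let B := tens_from A [seq so_obj X | X <- s] in hom B (p B) :=
  match s with
  | [::] => k
  | X :: s' => coframe_from (fmu p A X ∘ (k ⊗ₘ coframe p X)) s'
  end.

Definition coframe_seq p (s : seq (simple_obj C)) :
    let B := tens_seq [seq so_obj X | X <- s] in hom B (p B) :=
  match s with
  | [::] => feps p
  | X :: s' => coframe_from (coframe p X) s'
  end.

Lemma coframe_iso p X : is_iso (coframe p X).
Proof. exact: iso_invm. Qed.

Lemma coframe_from_iso p A (k : hom A (p A)) s :
  is_iso k -> is_iso (coframe_from k s).
Proof.
elim: s A k => [|X s IH] A k //= k_iso; apply: IH.
exact: iso_cmp (fmu_iso _ _ _) (tensm_iso k_iso (coframe_iso p X)).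
Qed.

Lemma coframe_seq_iso p s : is_iso (coframe_seq p s).
Proof.
case: s => [|X s]; first exact: feps_iso.
exact/coframe_from_iso/coframe_iso.
Qed.

Section Equivalence.
Variables (p q : frpair C) (e : tnatiso p q).
Hypothesis fr_e : forall i, fr_frame q i ∘ e (irr_obj i) = fr_frame p i.

Lemma frame_eqv X : frame q X ∘ e X = frame p X.
Proof. by rewrite /frame -!cmpA -tn_nat (cmpA _ (e _)) fr_e. Qed.

Lemma coframe_eqv X : e X ∘ coframe p X = coframe q X.
Proof.
apply: (iso_monic (frame_iso q X)).
by rewrite cmpA frame_eqv !coframeK.
Qed.

Lemma coframe_from_eqv A (k : hom A (p A)) (k' : hom A (q A)) s :
  e A ∘ k = k' -> e _ ∘ coframe_from k s = coframe_from k' s.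
Proof.
elim: s A k k' => [|X s IH] A k k' //= ek; apply: IH.
by rewrite cmpA tn_mu -cmpA -tensm_cmp ek coframe_eqv.
Qed.

Lemma coframe_seq_eqv s : e _ ∘ coframe_seq p s = coframe_seq q s.
Proof.
case: s => [|X s]; first exact: tn_eps.
exact/coframe_from_eqv/coframe_eqv.
Qed.

End Equivalence.

Section Composition.
Variables p q : frpair C.
Local Notation pq := (fr_comp p q).

Lemma frame_comp X : frame pq X = frame p X ∘ fmap p (frame q X).
Proof.
rewrite /frame /= !fmap_cmp -!cmpA; congr (_ ∘ (_ ∘ _)).
by rewrite [RHS]cmpA -(fmap_cmp p (irr_iso X)) invmVK fmap1 cmp1m.
Qed.

Lemma coframe_comp X : coframe pq X = fmap p (coframe q X) ∘ coframe p X.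
Proof.
apply: (iso_monic (frame_iso pq X)); rewrite coframeK frame_comp -cmpA.
by rewrite (cmpA (fmap p _) (fmap p _)) -fmap_cmp coframeK fmap1 cmp1m coframeK.
Qed.

Lemma coframe_from_comp A (k : hom A (pq A)) (k1 : hom A (p A))
    (k2 : hom A (q A)) s :
  k = fmap p k2 ∘ k1 ->
  coframe_from (p := pq) k s = fmap p (coframe_from k2 s) ∘ coframe_from k1 s.
Proof.
elim: s A k k1 k2 => [|X s IH] A k k1 k2 //= ->; apply: IH.
rewrite coframe_comp /= tensm_cmp fmap_cmp -!cmpA; congr (_ ∘ _).
by rewrite (cmpA (fmu p _ _)) fmu_nat -!cmpA.
Qed.

Lemma coframe_seq_comp s :
  coframe_seq pq s = fmap p (coframe_seq q s) ∘ coframe_seq p s.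
Proof. by case: s => [|X s] //; apply/coframe_from_comp/coframe_comp. Qed.

End Composition.

Section Operator.
Variables (Xs : seq (simple_obj C)) (Z : simple_obj C).
Local Notation V := (hom (tens_seq [seq so_obj X | X <- Xs]) (so_obj Z)).

Definition frame_op (p : frpair C) (h : V) : V :=
  frame p Z ∘ (fmap p h ∘ coframe_seq p Xs).

(** The isomorphism [e] carries frames to frames at Z and, being monoidal, coframes to coframes on
    the product; by naturality at [h] it drops out. *)
Lemma frame_op_class p q h : fr_class p = fr_class q ->
  frame_op p h = frame_op q h.
Proof.
case/fr_classP => _ [e fr_e]; rewrite /frame_op.
rewrite -(coframe_seq_eqv fr_e) -(frame_eqv fr_e) -!cmpA; congr (_ ∘ _).
by rewrite (cmpA (e Z)) tn_nat -!cmpA.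
Qed.

Lemma frame_op_comp p q h :
  frame_op (fr_comp p q) h = frame_op p (frame_op q h).
Proof.
by rewrite /frame_op frame_comp coframe_seq_comp /= !fmap_cmp -!cmpA.
Qed.

Lemma frame_op_inj p : injective (frame_op p).
Proof.
move=> g h /(iso_monic (frame_iso p Z))/(iso_epic (coframe_seq_iso p Xs)).
exact: bij_inj ((sf_equiv p).1 _ _) _ _.
Qed.

Lemma frame_op_semilin p a g h :
  frame_op p (a *: g + h) = sf_gal p a *: frame_op p g + frame_op p h.
Proof.
rewrite /frame_op ((twist_linearP _ _).1 (sf_lin p)).
by rewrite (cmp_linl (coframe_seq p Xs)) (cmp_linr (frame p Z)).
Qed.

Lemma frame_opZ p a h : frame_op p (a *: h) = sf_gal p a *: frame_op p h.
Proof. by rewrite /frame_op sf_fmapZ cmpZl cmpZr. Qed.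

(** The functor is the identity, the frame at Z contributes u_Z, and each coframe contributes an
    inverse u_X^-1. *)
Lemma frame_op_scalar u h :
  frame_op (fr_scalar u) h = uval (lambda_val Xs Z u) *: h.
Proof.
have frameE X :
    frame (fr_scalar u) X = uval (u (irr_class X)) *: idm (so_obj X).
  by rewrite /frame /= cmpZl cmpZr cmp1m invmK.
have coframeE X :
    coframe (fr_scalar u) X = (uval (u (irr_class X)))^-1 *: idm (so_obj X).
  apply: (iso_monic (frame_iso _ X)); rewrite coframeK frameE.
  by rewrite cmpZl cmpZr cmp1m scalerA mulfV ?scale1r ?uval_neq0.
have fromE s A (a : munit L) (k : hom A A) : k = (uval a)^-1 *: idm A ->
    coframe_from (p := fr_scalar u) k s
    = (uval (a + \sum_(X <- s) u (irr_class X)))^-1 *: idm _.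
  elim: s A a k => [|X s IH] A a k kE; first by rewrite big_nil addr0.
  rewrite big_cons addrA; apply: IH.
  rewrite kE [coframe _ X]coframeE tensmZl tensmZr tensm1 cmpZr cmpZr.
  by rewrite cmp1m scalerA uvalD invfM.
rewrite /frame_op; have -> : coframe_seq (fr_scalar u) Xs
    = (uval (\sum_(X <- Xs) u (irr_class X)))^-1 *: idm _.
  case: Xs => [|X s]; first by rewrite big_nil /= invr1 scale1r.
  by rewrite big_cons; apply: fromE.
by rewrite frameE /= cmpZl cmp1m cmpZr cmpm1 scalerA.
Qed.

End Operator.

End Frames.

(** * The extension of [Pi_sf] by [Q] *)

Section Extension.
Variables (K : fieldType) (L : splittingFieldType K) (C : fusion L).
Implicit Types (p q r : frpair C) (u v : {ffun irr C -> munit L}).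

(** Both sides agree on objects and morphisms, and their tensor constraints are equal by
    functoriality but not by conversion; hence a transformation with identity components. *)
Program Definition tn_assoc (F G H : tfunctor C) :
    tnatiso (tf_comp (tf_comp F G) H) (tf_comp F (tf_comp G H)) :=
  @TNatIso L C _ _ (fun X => idm (F (G (H X)))) _ _ _ _.
Next Obligation. exact: iso_idm. Qed.
Next Obligation. by rewrite cmp1m cmpm1. Qed.
Next Obligation. by rewrite tensm1 cmp1m cmpm1 fmap_cmp !cmpA. Qed.
Next Obligation. by rewrite cmp1m fmap_cmp !cmpA. Qed.

Program Definition tn_lunitV (F : tfunctor C) :
    tnatiso F (tf_comp (tf_id C) F) :=
  @TNatIso L C _ _ (fun X => idm (F X)) _ _ _ _.
Next Obligation. exact: iso_idm. Qed.
Next Obligation. by rewrite cmp1m cmpm1. Qed.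
Next Obligation. by rewrite tensm1 cmp1m !cmpm1. Qed.
Next Obligation. by rewrite cmp1m cmpm1. Qed.

Program Definition tn_runit (F : tfunctor C) :
    tnatiso (tf_comp F (tf_id C)) F :=
  @TNatIso L C _ _ (fun X => idm (F X)) _ _ _ _.
Next Obligation. exact: iso_idm. Qed.
Next Obligation. by rewrite cmp1m cmpm1. Qed.
Next Obligation. by rewrite fmap1 tensm1 cmpm1 !cmp1m. Qed.
Next Obligation. by rewrite fmap1 !cmp1m. Qed.

Lemma Pi_fr_mulA (x y z : Pi_fr C) :
  Pi_fr_mul (Pi_fr_mul x y) z = Pi_fr_mul x (Pi_fr_mul y z).
Proof.
rewrite -(fr_reprK x) -(fr_reprK y) -(fr_reprK z) !Pi_fr_mul_class.
apply/fr_classP; rewrite /= gmulA; split=> //; exists (tn_assoc _ _ _) => i /=.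
by rewrite cmpm1 fmap_cmp cmpA.
Qed.

Lemma Q_injD (x y : Q C) : Q_inj (x + y) = Pi_fr_mul (Q_inj x) (Q_inj y).
Proof.
rewrite -(Q_reprK x) -(Q_reprK y) !Q_inj_class Pi_fr_mul_class.
have -> : Q_class (Q_repr x) + Q_class (Q_repr y)
    = Q_class (Q_repr x + Q_repr y).
  rewrite -[Q_repr y in RHS]opprK Q_classB -[- Q_repr y]sub0r Q_classB.
  have := Q_classB (0 : {ffun irr C -> munit L}) 0; rewrite !subrr => ->.
  by rewrite sub0r opprK.
rewrite Q_inj_class; apply/fr_classP; rewrite /= gmul1.
split=> //; exists (tn_lunitV (tf_id C)) => i /=.
by rewrite cmpm1 cmpZl cmp1m scalerA !ffunE.
Qed.

(** A scalar leaves the semilinear functor [p] with [sf_gal p] applied to it; so conjugation in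
    [Pi_fr] induces the Galois action on [Q]. *)
Lemma fr_comp_scalar p u :
  fr_class (fr_comp p (fr_scalar u))
  = fr_class (fr_comp (fr_scalar (Aut_act (sf_gal p) u)) p).
Proof.
apply/fr_classP; split=> /=; first by rewrite gmul1 gmul1l.
exists (tn_comp (tn_lunitV p) (tn_runit p)) => i /=.
by rewrite !cmpm1 ffunE sf_fmapZ fmap1 cmpZr cmpm1 cmpZl cmp1m.
Qed.

Lemma cmp0m (X Y Z : C) (f : hom X Y) : (0 : hom Y Z) ∘ f = 0.
Proof. by rewrite -(scale0r (0 : hom Y Z)) cmpZl scale0r. Qed.

Lemma cmpm0 (X Y Z : C) (f : hom Y Z) : f ∘ (0 : hom X Y) = 0.
Proof. by rewrite -(scale0r (0 : hom X Y)) cmpZr scale0r. Qed.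

Lemma iso_neq0 (X Y : C) (f : hom Y X) : simple X -> is_iso f -> f != 0.
Proof.
case=> X_nz _ [g [_ fg]]; apply: contra_notN X_nz => /eqP f0 Z.
have id0 : idm X = 0 by rewrite -fg f0 cmp0m.
split=> h; first by rewrite -[h]cmpm1 id0 cmpm0.
by rewrite -[h]cmp1m id0 cmp0m.
Qed.

Hypothesis C_split : split_fusion C.

(** Schur's lemma in the split case: f g^-1 is a scalar, nonzero since X is not a zero object. *)
Lemma iso_scalar (X Y : C) (f g : hom Y X) : simple X -> is_iso f -> is_iso g ->
  exists a : munit L, f = uval a *: g.
Proof.
move=> sX f_iso g_iso; have [a [fa _]] := C_split sX (f ∘ invm g_iso).
have a0 : a != 0.
  apply: contraNneq (iso_neq0 sX f_iso) => a0; apply/eqP.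
  by rewrite -[f]cmpm1 -(invmK g_iso) cmpA fa a0 scale0r cmp0m.
exists (MUnit a0); rewrite /= -[f]cmpm1 -(invmK g_iso) cmpA fa cmpZl.
by rewrite cmp1m.
Qed.

(** Exactness in the middle: once a tensor isomorphism identifies the functors, the two frames
    differ by scalars. *)
Lemma fr_comp_scalar_ex p q : sf_class p = sf_class q ->
  exists u, fr_class p = fr_class (fr_comp (fr_scalar u) q).
Proof.
case/sf_classP => pq [e].
have scal i : exists a : munit L,
    fr_frame p i = uval a *: (fr_frame q i ∘ e (irr_obj i)).
  apply: iso_scalar (irr_simple i) (fr_iso p i) _.
  exact: iso_cmp (fr_iso q i) (tn_iso e _).
pose u : {ffun irr C -> munit L} := [ffun i => sval (cid (scal i))].
exists u; apply/fr_classP; rewrite /= gmul1l; split=> //.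
exists (tn_comp (tn_lunitV q) e) => i /=.
by rewrite cmp1m !cmpZl cmp1m ffunE [RHS](svalP (cid (scal i))).
Qed.

Section Transport.
Variables (p : sfpair C) (e : tnatiso p p).

Let preim X Y (f : hom (p X) (p Y)) : exists g : hom X Y, fmap p g = f.
Proof. by have [k _ kK] := (sf_equiv p).1 X Y; exists (k f). Qed.

Let d (X : C) : hom X X := sval (cid (preim (e X))).
Let dE X : fmap p (d X) = e X. Proof. exact: svalP (cid (preim (e X))). Qed.
Let fmap_inj X Y : injective (@fmap L C p X Y).
Proof. exact: bij_inj ((sf_equiv p).1 X Y). Qed.

(** As [p] is fully faithful, each component of [e] has a unique preimage; faithfulness reflects
    naturality and compatibility with the tensor structure. *)
Program Definition tn_preim : tnatiso (tf_id C) (tf_id C) :=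
  @TNatIso L C (tf_id C) (tf_id C) d _ _ _ _.
Next Obligation.
have [g [ge eg]] := tn_iso e X; have [h hg] := preim g; exists h.
by split; apply: fmap_inj; rewrite fmap_cmp fmap1 hg dE.
Qed.
Next Obligation. by apply: fmap_inj; rewrite !fmap_cmp !dE tn_nat. Qed.
Next Obligation.
rewrite cmpm1 cmp1m; apply: fmap_inj; rewrite dE.
apply: (iso_epic (fmu_iso p X Y)).
by rewrite tn_mu -fmu_nat !dE.
Qed.
Next Obligation.
rewrite cmpm1; apply: fmap_inj; rewrite dE fmap1.
by apply: (iso_epic (feps_iso p)); rewrite tn_eps cmp1m.
Qed.

Lemma fmap_tn_preim X : fmap p (tn_preim X) = e X.
Proof. exact: dE. Qed.

End Transport.

(** Both framed pairs have the same functor, so their equivalence is an automorphism of it and comes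
    from a monoidal automorphism of the identity. *)
Lemma fr_comp_scalar_inj p u v :
  fr_class (fr_comp (fr_scalar u) p) = fr_class (fr_comp (fr_scalar v) p) ->
  Q_class u = Q_class v.
Proof.
case/fr_classP => _ [e eE]; apply/Q_classP.
pose P := sf_comp (sf_id C) p; pose s := sf_gal P.
(* The functor applies s to scalars, so the preimage automorphism has scalars s^-1(u_i / v_i).
   Stability of [Aut_tens] under s then recovers u - v. *)
have -> : u - v = Aut_act s (Aut_act s^-1%g (u - v)).
  apply/ffunP => i; rewrite !ffunE; apply: val_inj.
  by rewrite /= -gmulE gmulV gal_id.
apply: (@Aut_tens_act K L C P); apply/asboolP.
exists (tn_preim (p := P) e) => i.
apply: (bij_inj ((sf_equiv P).1 _ _)); rewrite fmap_tn_preim sf_fmapZ fmap1.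
apply: (iso_monic (fr_iso (fr_comp (fr_scalar v) p) i)); rewrite [LHS]eE.
rewrite /= !cmpZl cmpZr !cmpm1 scalerA; congr (_ *: _).
have -> : uval (Aut_act s^-1%g (u - v) i) = s^-1%g (uval (u i) / uval (v i)).
  by rewrite !ffunE.
by rewrite -[gmul _ _]/s -gmulE gmulV gal_id mulrC divfK ?uval_neq0.
Qed.

End Extension.

(** * The obstruction class and its twisted representation *)

Section Omega.
Variables (K : fieldType) (L : splittingFieldType K) (C : fusion L).

Lemma fr_forgetM (x y : Pi_fr C) :
  fr_forget (Pi_fr_mul x y) = Pi_sf_mul (fr_forget x) (fr_forget y).
Proof.
rewrite -(fr_reprK x) -(fr_reprK y) Pi_fr_mul_class !fr_forget_class.
by rewrite Pi_sf_mul_class.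
Qed.

Lemma Pi_fr_mul_Q_inj (z : Pi_fr C) (x : Q C) :
  Pi_fr_mul z (Q_inj x) = Pi_fr_mul (Q_inj (Q_act (p_sf (fr_forget z)) x)) z.
Proof.
rewrite -(fr_reprK z) fr_forget_class p_sf_class Q_inj_class.
by rewrite !Pi_fr_mul_class fr_comp_scalar.
Qed.

Hypothesis C_split : split_fusion C.

Lemma fr_forget_eq (x y : Pi_fr C) : fr_forget x = fr_forget y ->
  exists z, x = Pi_fr_mul (Q_inj z) y.
Proof.
rewrite -(fr_reprK x) -(fr_reprK y) !fr_forget_class.
case/(fr_comp_scalar_ex C_split) => u ->; exists (Q_class u).
by rewrite Q_inj_class Pi_fr_mul_class.
Qed.

Lemma Q_inj_mulIr (x y : Q C) z :
  Pi_fr_mul (Q_inj x) z = Pi_fr_mul (Q_inj y) z -> x = y.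
Proof.
rewrite -(fr_reprK z) !Pi_fr_mul_class => /fr_comp_scalar_inj.
by rewrite !Q_reprK.
Qed.

Variable Phi : sf_section C.

(** Frames are chosen on representatives of the Phi(s); exactness in the middle gives the factor
    set, and associativity its cocycle identity. *)
Lemma is_Omega_ex : exists c, is_Omega (Phi := Phi) c.
Proof.
have frame_ex s i : exists f : hom (sf_repr (Phi s) (irr_obj i)) (irr_obj i),
    is_iso f by exact: sf_fix (irr_simple i).
pose lift s := fr_class (FrPair (fun i => svalP (cid (frame_ex s i)))).
have lift_Phi s : fr_forget (lift s) = Phi s.
  by rewrite fr_forget_class sf_reprK.
have lift_mul st : exists x,
    Pi_fr_mul (lift st.1) (lift st.2)
    = Pi_fr_mul (Q_inj x) (lift (gmul st.1 st.2)).
  by apply: fr_forget_eq; rewrite fr_forgetM !lift_Phi secM.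
pose b := [ffun st => sval (cid (lift_mul st))] : {ffun _ -> Q_mod Phi}.
have bE s t : Pi_fr_mul (lift s) (lift t)
    = Pi_fr_mul (Q_inj (b (s, t))) (lift (gmul s t)).
  by rewrite ffunE -(svalP (cid (lift_mul (s, t)))).
have bZ : cocycle2 b.
  (* The two sides are the coefficients of lift s, lift t, lift r multiplied in the two bracketings;
     moving b(t, r) past lift s produces the action of s. *)
  apply/asboolP => s t r; apply: (@Q_inj_mulIr _ _ (lift (gmul (gmul s t) r))).
  rewrite !Q_injD !Pi_fr_mulA -bE -gmulA -bE.
  have {1}-> : s = p_sf (fr_forget (lift s)) by rewrite lift_Phi secK.
  by rewrite -!Pi_fr_mulA -bE -Pi_fr_mul_Q_inj !Pi_fr_mulA bE.
by exists (H2_class (Cocycle2 bZ)), lift, (Cocycle2 bZ).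
Qed.

Lemma OmegaP : is_Omega (Omega Phi).
Proof. exact: xgetPex is_Omega_ex. Qed.

Section Operators.
Variables (Xs : seq (simple_obj C)) (Z : simple_obj C).
Hypothesis n_gt0 : (0 < fusion_mult Xs Z)%N.
Local Notation V := (hom (tens_seq [seq so_obj X | X <- Xs]) (so_obj Z)).
Variables (lift : gal_of {:L} -> Pi_fr C) (b : Z2 (Q_mod Phi)).
Hypothesis lift_Phi : forall s, fr_forget (lift s) = Phi s.
Hypothesis lift_mul : forall s t,
  Pi_fr_mul (lift s) (lift t) = Pi_fr_mul (Q_inj (b (s, t))) (lift (gmul s t)).

Definition lift_op s (h : V) : V := frame_op (fr_repr (lift s)) h.

Lemma sf_gal_lift s : sf_gal (fr_repr (lift s)) = s.
Proof. by rewrite -p_sf_class -[sf_class _]/(fr_forget _) lift_Phi secK. Qed.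

Lemma lift_op_mul s t h :
  lift_op s (lift_op t h)
  = uval (Z2_map (lambda n_gt0 Phi) b (s, t)) *: lift_op (gmul s t) h.
Proof.
rewrite /lift_op -frame_op_comp ffunE -[uval _ *: _]frame_op_scalar.
rewrite -frame_op_comp; apply: frame_op_class; have := lift_mul s t.
rewrite -{1}(fr_reprK (lift s)) -{1}(fr_reprK (lift t)).
by rewrite -{1}(fr_reprK (lift (gmul s t))) !Pi_fr_mul_class.
Qed.

Lemma lift_op_semilin s a g h :
  lift_op s (a *: g + h) = s a *: lift_op s g + lift_op s h.
Proof. by rewrite /lift_op frame_op_semilin sf_gal_lift. Qed.

Definition lift_twrep :
    twrep (fun s t => Z2_map (lambda n_gt0 Phi) b (s, t) : munit L) :=
  @twrep_inj K L (fun s t => Z2_map (lambda n_gt0 Phi) b (s, t)) V lift_op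
    lift_op_semilin (fun s => @frame_op_inj K L C Xs Z _) lift_op_mul.

Lemma ind_lift : galois 1 {:L} ->
  (ind (H2_class (Z2_map (lambda n_gt0 Phi) b)) %| fusion_mult Xs Z)%N.
Proof. by move=> galL; apply: (ind_dvd_dim (V := lift_twrep)). Qed.

Lemma H2_class_lift :
  H2_class (Z2_map (lambda n_gt0 Phi) b) *+ fusion_mult Xs Z = 0.
Proof. exact: (H2_class_dim lift_twrep). Qed.

End Operators.

End Omega.

(** * Coherent structures *)

Section Coherent.
Variables (K : fieldType) (L : splittingFieldType K) (C : fusion L).
Hypothesis C_split : split_fusion C.
Variables (Phi : sf_section C) (J : coherent Phi).

Lemma sf_gal_co_rep s : sf_gal (co_rep J s) = s.
Proof. by rewrite -p_sf_class co_rep_class secK. Qed.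

Lemma co_fmapZ s (X Y : C) a (f : hom X Y) :
  fmap (co_rep J s) (a *: f) = s a *: fmap (co_rep J s) f.
Proof. by rewrite sf_fmapZ sf_gal_co_rep. Qed.

(** Two choices of f differ by scalars h(s), so their cocycles differ by the coboundary of h. Hence
    [beta] can be computed from any choice. *)
Lemma is_beta_uniq (X : simple_obj C) c c' :
  is_beta J X c -> is_beta J X c' -> c = c'.
Proof.
case=> f [b [f_iso fE ->]] [f' [b' [f'_iso f'E ->]]].
have sX := so_simple X.
have scal s : exists a : munit L, f s = uval a *: f' s.
  exact: iso_scalar C_split _ _ (f s) (f' s) sX (f_iso s) (f'_iso s).
pose h s := sval (cid (scal s)).
have fh s : f s = uval (h s) *: f' s := svalP (cid (scal s)).
apply: (@H2_class_eqP K L (munit_mod L) b b' h) => s t; apply: val_inj => /=.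
have /eqP := fE s t; rewrite !fh co_fmapZ cmpZl cmpZr cmpZl f'E !scalerA.
rewrite -subr_eq0 -scalerBl scaler_eq0.
have := iso_neq0 sX (iso_cmp (f'_iso (gmul s t)) (tn_iso (co_J J s t) X)).
move=> /negPf ->; rewrite orbF subr_eq0 => /eqP.
have := uval_neq0 (h (gmul s t)); have := uval_neq0 (b' (s, t)).
move=> b0 h0 e; apply: (mulIf b0); rewrite divfK //.
apply: (mulIf h0); rewrite -e.
by field.
Qed.

Lemma co_frame_ex s i : exists f : hom (co_rep J s (irr_obj i)) (irr_obj i),
  is_iso f.
Proof. exact: sf_fix (irr_simple i). Qed.

Definition co_lift s : frpair C :=
  FrPair (fun i => svalP (cid (co_frame_ex s i))).

Lemma co_cocycle_ex st i : exists a : munit L,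
  fr_frame (fr_comp (co_lift st.1) (co_lift st.2)) i
  = uval a *:
    (fr_frame (co_lift (gmul st.1 st.2)) i ∘ co_J J st.1 st.2 (irr_obj i)).
Proof.
apply: (iso_scalar C_split (irr_simple i)); first exact: fr_iso.
exact: iso_cmp (fr_iso _ _) (tn_iso _ _).
Qed.

(** These are the b_X(s, t) for all representatives at once: a family in Aut(id) whose image in [Q]
    is the factor set of the lifts [co_lift]. *)
Definition co_scalar st : {ffun irr C -> munit L} :=
  [ffun i => sval (cid (co_cocycle_ex st i))].

Lemma co_scalarE s t i :
  fr_frame (co_lift s) i ∘ fmap (co_rep J s) (fr_frame (co_lift t) i)
  = uval (co_scalar (s, t) i) *:
    (fr_frame (co_lift (gmul s t)) i ∘ co_J J s t (irr_obj i)).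
Proof. by rewrite ffunE -(svalP (cid (co_cocycle_ex (s, t) i))). Qed.

Lemma co_lift_mul s t : fr_class (fr_comp (co_lift s) (co_lift t))
  = fr_class (fr_comp (fr_scalar (co_scalar (s, t))) (co_lift (gmul s t))).
Proof.
apply/fr_classP; rewrite /= !sf_gal_co_rep gmul1l; split=> //.
exists (tn_comp (tn_lunitV (co_rep J (gmul s t))) (co_J J s t)) => i.
by rewrite [RHS]co_scalarE /= cmp1m !cmpZl cmp1m.
Qed.

(** The two bracketings of a triple product in the Galois group are only propositionally equal, so
    frames over them are compared through [idcast]. *)
Lemma idcast_frame (g g' : gal_of {:L}) (e : g = g') i :
  fr_frame (co_lift g') i
    ∘ idcast (congr1 (fun g => co_rep J g (irr_obj i)) e)
  = fr_frame (co_lift g) i.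
Proof. by case: _ / e; rewrite cmpm1. Qed.

(** The composite of f_s, Phi_s(f_t) and Phi_s Phi_t(f_r) is reduced in two ways. By [co_JA] both
    are multiples of the same nonzero morphism [w], and the scalars are the two sides of the cocycle
    identity. *)
Lemma co_scalar_cocycle i :
  cocycle2 ([ffun st => co_scalar st i] : {ffun _ -> munit_mod L}).
Proof.
apply/asboolP => s t r; rewrite !ffunE; apply: val_inj => /=.
pose f s := fr_frame (co_lift s) i.
pose w := f (gmul s (gmul t r))
  ∘ (co_J J s (gmul t r) (irr_obj i)
     ∘ fmap (co_rep J s) (co_J J t r (irr_obj i))).
have w0 : w != 0.
  apply: (iso_neq0 (irr_simple i)).
  apply: iso_cmp; first exact: (fr_iso (co_lift _)).
  by apply: iso_cmp; [exact: tn_iso | apply: fmap_iso; exact: tn_iso].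
have e1 : f s ∘ fmap (co_rep J s) (f t ∘ fmap (co_rep J t) (f r))
    = (s (uval (co_scalar (t, r) i)) * uval (co_scalar (s, gmul t r) i)) *: w.
  rewrite co_scalarE co_fmapZ fmap_cmp cmpZr cmpA co_scalarE cmpZl scalerA.
  by rewrite -!cmpA.
have e2 : f s ∘ fmap (co_rep J s) (f t ∘ fmap (co_rep J t) (f r))
    = (uval (co_scalar (s, t) i) * uval (co_scalar (gmul s t, r) i)) *: w.
  rewrite fmap_cmp cmpA co_scalarE cmpZl -cmpA.
  have -> :
      co_J J s t (irr_obj i) ∘ fmap (co_rep J s) (fmap (co_rep J t) (f r))
      = fmap (co_rep J (gmul s t)) (f r) ∘ co_J J s t (co_rep J r (irr_obj i)).
    exact: (tn_nat (co_J J s t) (f r)).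
  rewrite cmpA co_scalarE cmpZl scalerA -cmpA /w -co_JA cmpA; congr (_ *: _).
  by rewrite -(idcast_frame (esym (gmulA s t r))) -!cmpA.
move/eqP: e1; rewrite e2 -subr_eq0 -scalerBl scaler_eq0 (negPf w0) orbF.
rewrite subr_eq0.
by move/eqP/esym; rewrite !ffunE.
Qed.

Definition co_cocycle i : Z2 (munit_mod L) := Cocycle2 (co_scalar_cocycle i).

(** The frame at X is conjugate to that of its representative, and J is natural along [irr_iso X],
    so the same scalars occur. *)
Lemma is_beta_co_cocycle X : is_beta J X (H2_class (co_cocycle (irr_class X))).
Proof.
exists (fun s => frame (co_lift s) X), (co_cocycle (irr_class X)).
split=> // [s | s t]; first exact: (@frame_iso K L C (co_lift s) X).
rewrite ffunE -[LHS](frame_comp (co_lift s) (co_lift t)).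
rewrite /frame /= co_scalarE -!cmpA !cmpZl cmpZr; congr (_ *: (_ ∘ _)).
by rewrite -!cmpA (tn_nat (co_J J s t)).
Qed.

Lemma beta_co_cocycle X : beta J X = H2_class (co_cocycle (irr_class X)).
Proof.
apply: is_beta_uniq (is_beta_co_cocycle X).
apply: xgetPex; exists (H2_class (co_cocycle (irr_class X))).
exact: is_beta_co_cocycle.
Qed.

Variables (Xs : seq (simple_obj C)) (Z : simple_obj C).
Hypothesis n_gt0 : (0 < fusion_mult Xs Z)%N.

Local Notation V := (hom (tens_seq [seq so_obj X | X <- Xs]) (so_obj Z)).

(** Arbitrary lifts differ from the coherent frames by families u(s), so their operators differ by
    the scalars lambda(u(s)). This cochain bounds the difference of the two cocycles. *)
Lemma Omega_beta (c : H2 (Q_mod Phi)) : is_Omega c ->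
  H2_map (lambda n_gt0 Phi) c = beta J Z - \sum_(X <- Xs) beta J X.
Proof.
case=> lift [b [lift_Phi lift_mul ->]]; rewrite H2_map_class beta_co_cocycle.
under eq_bigr => X _ do rewrite beta_co_cocycle.
rewrite -H2_class_sum -H2_classB.
have scal s : exists u, lift s = fr_class (fr_comp (fr_scalar u) (co_lift s)).
  have [|u e] :=
      @fr_comp_scalar_ex K L C C_split (fr_repr (lift s)) (co_lift s).
    by rewrite co_rep_class -lift_Phi.
  by exists u; rewrite -e fr_reprK.
pose u s := sval (cid (scal s)).
have uE s : lift s = fr_class (fr_comp (fr_scalar (u s)) (co_lift s)) :=
  svalP (cid (scal s)).
have opE s (h : V) : lift_op lift s h
    = uval (lambda_val Xs Z (u s)) *: frame_op (co_lift s) h.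
  rewrite /lift_op -frame_op_scalar -frame_op_comp; apply: frame_op_class.
  by rewrite fr_reprK.
(* A nonzero [h] exists because n > 0; it lets scalars be compared through their operators. *)
have [h h0] : exists h : V, h != 0.
  by exists (vpick {:_}); rewrite vpick0 -dimv_eq0 -lt0n.
apply: (@H2_class_eqP K L (munit_mod L) _ _
  (fun s => lambda_val Xs Z (u s))) => s t.
have := lift_op_mul n_gt0 lift_mul s t h.
rewrite !opE frame_opZ sf_gal_co_rep -frame_op_comp.
rewrite (frame_op_class _ (co_lift_mul s t)).
rewrite frame_op_comp frame_op_scalar !scalerA => /eqP.
set w := frame_op _ _; have w0 : w != 0.
  apply: contraNneq h0 => w0; apply/eqP.
  apply: (@frame_op_inj _ _ _ _ _ (co_lift (gmul s t))).
  by rewrite -/w w0 -[X in frame_op _ X](scale0r h) frame_opZ rmorph0 scale0r.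
rewrite -subr_eq0 -scalerBl scaler_eq0 (negPf w0) orbF subr_eq0 => /eqP e.
have -> : (co_cocycle (irr_class Z)
           - \sum_(X <- Xs) co_cocycle (irr_class X)) (s, t)
    = lambda_val Xs Z (co_scalar (s, t)).
  have sumE r : (\sum_(X <- r) co_cocycle (irr_class X)) (s, t)
      = \sum_(X <- r) co_scalar (s, t) (irr_class X).
    elim: r => [|X r IH]; first by rewrite !big_nil ffunE.
    by rewrite !big_cons -IH ffunE; congr (_ + _); rewrite /= ffunE.
  by rewrite /lambda_val -sumE ffunE; congr (_ + _); rewrite /= ffunE.
have e' : lambda_val Xs Z (u s) + munit_act s (lambda_val Xs Z (u t))
    + lambda_val Xs Z (co_scalar (s, t))
    = Z2_map (lambda n_gt0 Phi) b (s, t) + lambda_val Xs Z (u (gmul s t)).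
  by apply: val_inj.
by rewrite -(canLR (addrK _) e') addrAC addrK -addrA addrC.
Qed.

End Coherent.

Theorem proposition2p7 (K : fieldType) (L : splittingFieldType K)
    (LK_galois : galois 1 {:L})
    (C : fusion L) (C_split : split_fusion C) (Phi : sf_section C)
    (Xs : seq (simple_obj C)) (Z : simple_obj C)
    (n_gt0 : (0 < fusion_mult Xs Z)%N) :
  (ind (H2_map (lambda n_gt0 Phi) (Omega Phi)) %| fusion_mult Xs Z)%N /\
  forall J : coherent Phi,
    H2_map (lambda n_gt0 Phi) (Omega Phi)
      = beta J Z - \sum_(X <- Xs) beta J X /\
    (beta J Z - \sum_(X <- Xs) beta J X) *+ fusion_mult Xs Z = 0.
Proof.
have [lift [b [lift_Phi lift_mul OmegaE]]] := OmegaP C_split Phi.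
split=> [|J].
  by rewrite OmegaE H2_map_class; apply: ind_lift lift_Phi lift_mul LK_galois.
have Omega_J := Omega_beta C_split J n_gt0 (OmegaP C_split Phi).
split=> //; rewrite -Omega_J OmegaE H2_map_class.
(* The torsion relation comes from the determinants of the operators on the n-dimensional
   multiplicity space. *)
exact: H2_class_lift lift_Phi lift_mul.
Qed.
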